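(* (1) If $\mathfrak{X}$ is a $\Sigma^*$-module over a $\Sigma^*$-algebra $\mathfrak{B} \subseteq B(\mathcal{H})$, then (the canonical image of) $\mathfrak{X}$ is a WOT sequentially closed TRO in $B(\mathcal{H}, \mathfrak{X} \otimes_{\mathfrak{B}} \mathcal{H})$. Conversely, if $\mathfrak{Z}$ is a nondegenerate WOT sequentially closed TRO in $B(\mathcal{K}_1,\mathcal{K}_2)$, for Hilbert spaces $\mathcal{K}_1,\mathcal{K}_2$, then $\mathfrak{Z}$ is a $\Sigma^*$-module over $\mathscr{B}(\mathfrak{Z}^*\mathfrak{Z})$ with module action given by composition of operators and inner product $\langle z_1|z_2 \rangle = z_1^* z_2$. (2) If $\mathfrak{D} \subseteq B(\mathcal{K})$ is a $\Sigma^*$-algebra, $p,q \in M(\mathfrak{D})$ are projections, and $\mathfrak{Y} = p\mathfrak{D}q$, then $\mathfrak{Y}$ is a $\Sigma^*$-module over $q\mathfrak{D}q \subseteq B(q\mathcal{K})$ with the canonical structure (module action by multiplication, inner product $\langle y_1|y_2\rangle = y_1^*y_2$). Conversely, if $\mathfrak{X}$ is a $\Sigma^*$-module over a $\Sigma^*$-algebra $\mathfrak{B} \subseteq B(\mathcal{H})$, then there exist a $\Sigma^*$-algebra $\mathfrak{C} \subseteq B(\mathcal{K})$, a projection $p \in M(\mathfrak{C})$, an isometric (linear) isomorphism $\varphi : \mathfrak{X} \to (1-p)\mathfrak{C}p$ and a $\Sigma^*$-isomorphism $\psi : \mathfrak{B} \to p\mathfrak{C}p$ such that $\varphi(xb)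 = \varphi(x)\psi(b)$ and $\psi(\langle x|y\rangle) = \varphi(x)^*\varphi(y)$ for all $x,y \in \mathfrak{X}$ and $b \in \mathfrak{B}$.
   Context: WOT is the weak operator topology. A (concrete) $\Sigma^*$-algebra is a nondegenerate $C^*$-algebra $\mathfrak{B} \subseteq B(\mathcal{H})$ such that the limit in $B(\mathcal{H})$ of every WOT-convergent sequence in $\mathfrak{B}$ lies in $\mathfrak{B}$. For $\Sigma^*$-algebras $\mathfrak A,\mathfrak B$, a $*$-homomorphism $\varphi:\mathfrak A\to\mathfrak B$ is a $\Sigma^*$-homomorphism if $a_n \to a$ WOT in $\mathfrak A$ (sequences) implies $\varphi(a_n) \to \varphi(a)$ WOT in $\mathfrak B$; a $\Sigma^*$-isomorphism is a $*$-isomorphism such that it and its inverse are $\Sigma^*$-homomorphisms. A $C^*$-module over a $C^*$-algebra $A$ means a right Hilbert $C^*$-module, with $A$-valued inner product $\langle\cdot|\cdot\rangle$ linear and $A$-linear in the second variable and conjugate-linear in the first. If $A \subseteq B(\mathcal{H})$ is nondegenerate and $X$ is a $C^*$-module over $A$, then $X \otimes_A \mathcal{H}$ is the Hilbert space completion of the algebraic module tensor product $X \odot_A \mathcal{H}$ for the inner product determined by $\langle x\otimes\zeta, y\otimes\eta\rangle = \langle \zeta, \langle x|y\rangle\eta\rangle$, and $X$ is canonically embedded in $B(\mathcal{H}, X\otimes_A\mathcal{H})$ by $x(\zeta) = x\otimes\zeta$. A $C^*$-module $\mathfrak{X}$ over a $\Sigma^*$-algebra $\mathfrak{B}\subseteq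 B(\mathcal{H})$ is a $\Sigma^*$-module if its canonical image in $B(\mathcal{H},\mathfrak{X}\otimes_{\mathfrak{B}}\mathcal{H})$ is WOT sequentially closed. $\mathscr{B}(S)$ denotes the smallest WOT sequentially closed subset of the ambient operator space containing $S$. A TRO (ternary ring of operators) is a subspace $Z \subseteq B(\mathcal{H},\mathcal{K})$ with $xy^*z \in Z$ for all $x,y,z\in Z$; it is nondegenerate if the closed linear span $[Z\mathcal{H}]$ equals $\mathcal{K}$. $\mathfrak{Z}^*\mathfrak{Z}$ denotes the linear span of the products $z_1^*z_2$, $z_1,z_2\in\mathfrak{Z}$. If $\mathscr{B}(\mathfrak{Z}^*\mathfrak{Z})$ does not act nondegenerately on $\mathcal{K}_1$, it is regarded as a concrete $\Sigma^*$-algebra acting on the closed subspace $[\mathfrak{Z}^*\mathfrak{Z}\mathcal{K}_1]$. The multiplier algebra $M(\mathfrak{D})$ of a nondegenerate $C^*$-algebra $\mathfrak D\subseteq B(\mathcal{K})$ is identified with $\{T\in B(\mathcal{K}) : T\mathfrak{D}\subseteq\mathfrak{D},\ \mathfrak{D}T\subseteq\mathfrak{D}\}$; $1$ is the identity operator. *)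

(* Defs.v *)
From HB Require Import structures.
From mathcomp Require Import all_boot all_order all_algebra.
From mathcomp Require Import sesquilinear complex.
From mathcomp Require Import all_classical all_reals all_analysis.
Set Implicit Arguments.
Unset Strict Implicit.
Unset Printing Implicit Defensive.
Import Order.TTheory GRing.Theory Num.Theory.
Import numFieldNormedType.Exports.
Local Open Scope classical_set_scope.
Local Open Scope ring_scope.
Local Open Scope complex_scope.

(* [{dot H for Num.conj}] is linear in its first argument. *)
HB.mixin Record isHilbert (R : realType) H & CompleteNormedModule R[i] H := {
  dotp : {dot H for Num.conj} ;
  sqr_norm_dotp : forall x : H, `|x| ^+ 2 = dotp x x }.

#[short(type="hilbertType")]
HB.structure Definition Hilbert (R : realType) :=
  {H of CompleteNormedModule R[i] H & isHilbert R H}.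

(* The convention for inner products is conjugate-linear in the first argument
   and linear in the second one. *)
Definition inner (R : realType) (H : hilbertType R) (x y : H) : R[i] :=
  dotp y x.

Definition is_subspace (R : realType) (V : lmodType R[i]) (A : set V) : Prop :=
  A 0 /\ forall (c : R[i]) (x y : V), A x -> A y -> A (c *: x + y).

Definition lspan (R : realType) (V : lmodType R[i]) (S : set V) : set V :=
  smallest (@is_subspace R V) S.

Record closed_subspace (R : realType) (H : hilbertType R) := ClosedSubspace {
  csub_set : set H ;
  csub_subspace : is_subspace csub_set ;
  csub_closed : closed csub_set }.

Section ClosedSubspaceHilbert.
Variables (R : realType) (H : hilbertType R) (L : closed_subspace H).

Definition csub_pred : {pred H} := fun x => `[< csub_set L x >].

Lemma csub_submod : submod_closed csub_pred.
Proof.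
have [L0 LD] := csub_subspace L; split; first exact/asboolP.
by move=> c x y /asboolP Lx /asboolP Ly; apply/asboolP/LD.
Qed.

HB.instance Definition _ :=
  GRing.isSubmodClosed.Build R[i] H csub_pred csub_submod.

Definition csub_type : Type := {x : H | x \in csub_pred}.
HB.instance Definition _ := SubType.on csub_type.
HB.instance Definition _ := Choice.on csub_type.
HB.instance Definition _ := [SubChoice_isSubLmodule of csub_type by <:].


Let norm (x : csub_type) : R[i] := `|\val x|.

Let ler_normD x y : norm (x + y) <= norm x + norm y.
Proof. exact: ler_normD. Qed.

Let normrZ (c : R[i]) x : norm (c *: x) = `|c| * norm x.
Proof. exact: normrZ. Qed.

Let normr0_eq0 x : norm x = 0 -> x = 0.
Proof. by move=> /normr0_eq0 x0; apply: val_inj. Qed.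

HB.instance Definition _ :=
  Lmodule_isNormed.Build R[i] csub_type ler_normD normrZ normr0_eq0.

Let csub_complete (F : set_system csub_type) :
  ProperFilter F -> cauchy F -> cvg F.
Proof.
move=> FF /cauchy_ballP Fc.
have: cauchy ((\val : csub_type -> H) @ F).
  apply/cauchy_ballP => e e0; have [A [FA1 FA2] AE] := Fc e e0.
  exists ((\val : csub_type -> H) @` A.1, \val @` A.2) => /=.
    split; [apply: filterS FA1|apply: filterS FA2] => x Ax; by exists x.
  move=> [_ _] [/= [a Aa <-] [b Ab <-]].
  by have := AE (a, b) (conj Aa Ab); rewrite /= -!ball_normE.
move=> /cauchy_cvg /cvg_ex [h Fh].
have Lh : csub_set L h.
  apply: csub_closed.
  move=> B /Fh FB.
  have /filter_ex [x Bx] : F ((\val : csub_type -> H) @^-1` B) by exact: FB.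
  by exists (\val x); split=> //; apply/asboolP/(valP x).
apply/cvg_ex; exists (exist _ h (introT (asboolP _) Lh) : csub_type).
apply/cvgrPdist_lt => e e0; near=> x.
rewrite -[X in X < _]/(`|h - \val x|).
by near: x; move/cvgrPdist_lt: Fh; apply.
Unshelve. all: by end_near. Qed.

HB.instance Definition _ := Uniform_isComplete.Build csub_type csub_complete.
HB.instance Definition _ := CompleteNormedModule.on csub_type.

Definition csub_dot (x y : csub_type) : R[i] := dotp (\val x) (\val y).

Let dot_bilinear : bilinear_for *%R (Num.conj \; *%R) csub_dot.
Proof.
split=> [y|x] c u v; rewrite /csub_dot (linearP (\val : csub_type -> H)).
  by rewrite linearPl.
by rewrite linearPr.
Qed.

Let dot_hermitian (x y : csub_type) :
  csub_dot x y = (-1) ^+ false * Num.conj (csub_dot y x).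
Proof. exact: hermC. Qed.

Let dot_gt0 (x : csub_type) : x != 0 -> 0 < csub_dot x x.
Proof. by move=> x0; apply: neq0_dnorm_gt0. Qed.

HB.instance Definition _ :=
  bilinear_isBilinear.Build R[i] csub_type csub_type R[i] *%R (Num.conj \; *%R)
    csub_dot dot_bilinear.
HB.instance Definition _ :=
  isHermitianSesquilinear.Build R[i] csub_type false Num.conj csub_dot
    dot_hermitian.
HB.instance Definition _ := isDotProduct.Build R[i] csub_type csub_dot dot_gt0.

Let sqr_norm_dot (x : csub_type) : `|x| ^+ 2 = csub_dot x x.
Proof. exact: sqr_norm_dotp. Qed.

HB.instance Definition _ :=
  @isHilbert.Build R csub_type csub_dot sqr_norm_dot.

End ClosedSubspaceHilbert.

Section ClosedSpan.
Variables (R : realType) (H : hilbertType R).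

Lemma lspan_subspace (V : lmodType R[i]) (S : set V) : is_subspace (lspan S).
Proof.
split=> [A [[A0 _] _] //|c x y Sx Sy A [AS SA]].
by apply: AS.2; [apply: Sx|apply: Sy].
Qed.

Lemma closure_subspace (A : set H) : is_subspace A -> is_subspace (closure A).
Proof.
move=> [A0 AD]; split; first exact: subset_closure.
move=> c x y Ax Ay B.
have cD : continuous (fun p : H * H => c *: p.1 + p.2).
  move=> p; apply: cvgD; last exact: cvg_snd.
  by apply: cvgZl_tmp; apply: cvg_fst.
move=> /(cD (x, y)) [[U V] /= [xU yV] UV].
have [u [Au Uu]] := Ax _ xU; have [v [Av Vv]] := Ay _ yV.
exists (c *: u + v); split; first exact: AD.
exact: (UV (u, v)).
Qed.

Definition closed_span (S : set H) : closed_subspace H :=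
  ClosedSubspace (closure_subspace (lspan_subspace S)) (@closed_closure _ _).

End ClosedSpan.

Section Operators.
Variables (R : realType) (H K : hilbertType R).
Implicit Types (T : H -> K) (A Z : set (H -> K)).

Definition bounded_ops : set (H -> K) := [set T | linear T /\ continuous T].

(* Every bounded operator has a unique adjoint, so that the default value 0 is
   not used on [bounded_ops]. *)
Definition adj T : K -> H :=
  xget 0 [set S | forall x y, inner (T x) y = inner x (S y)].

Definition opnorm T : R :=
  sup [set complex.Re `|T x| | x in [set x : H | `|x| <= 1]].

Definition wot_cvg (a : nat -> H -> K) (T : H -> K) : Prop :=
  forall x y, inner y (a n x) @[n --> \oo] --> (inner y (T x) : R[i]^o).

Definition wot_seq_closed A : Prop :=
  forall (a : nat -> H -> K) (T : H -> K), (forall n, A (a n)) ->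
    bounded_ops T -> wot_cvg a T -> A T.

Definition wot_seq_closure A : set (H -> K) :=
  smallest [set M | M `<=` bounded_ops /\ wot_seq_closed M] A.

Definition ess_space A : closed_subspace K :=
  closed_span [set k | exists2 T, A T & exists x, k = T x].

Definition acts_nondegenerately A : Prop := csub_set (ess_space A) = setT.

End Operators.

Section TRO.
Variables (R : realType) (H K : hilbertType R).

Definition tro (Z : set (H -> K)) : Prop :=
  [/\ Z `<=` @bounded_ops R H K, is_subspace Z &
      forall x y z, Z x -> Z y -> Z z -> Z (x \o adj y \o z)].

Definition tro_algebra (Z : set (H -> K)) : set (H -> H) :=
  lspan [set T | exists z1 z2, [/\ Z z1, Z z2 & T = adj z1 \o z2]].

End TRO.

Section SigmaAlgebras.
Variables (R : realType) (H : hilbertType R).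
Implicit Types A D : set (H -> H).

Definition norm_closed A : Prop :=
  forall (a : nat -> H -> H) (T : H -> H), (forall n, A (a n)) ->
    bounded_ops T -> opnorm (a n - T) @[n --> \oo] --> (0 : R) -> A T.

Definition cstar_algebra A : Prop :=
  [/\ A `<=` @bounded_ops R H H, is_subspace A,
      forall S T, A S -> A T -> A (S \o T), forall T, A T -> A (adj T) &
      norm_closed A].

Definition sigmastar_algebra A : Prop :=
  [/\ cstar_algebra A, acts_nondegenerately A & wot_seq_closed A].

Definition projection (p : H -> H) : Prop :=
  [/\ bounded_ops p, p \o p = p & adj p = p].

Definition multiplier_algebra D : set (H -> H) :=
  [set T | bounded_ops T /\ forall d, D d -> D (T \o d) /\ D (d \o T)].

Definition corner (p : H -> H) D (q : H -> H) : set (H -> H) :=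
  [set p \o d \o q | d in D].

(* The range of a projection q is already a closed subspace, so that this is q H
   itself. *)
Definition range_space (q : H -> H) : closed_subspace H :=
  closed_span (range q).

End SigmaAlgebras.

Section Compression.
Variables (R : realType) (H : hilbertType R) (L : closed_subspace H).

Definition incl : csub_type L -> H := \val.

(* The adjoint of the inclusion is the orthogonal projection of H onto L; an
   operator b on L is identified with the operator [extend b] on H, which is 0
   on the orthogonal complement of L. *)
Definition compress (T : H -> H) : csub_type L -> csub_type L :=
  adj incl \o T \o incl.

Definition extend (b : csub_type L -> csub_type L) : H -> H :=
  incl \o b \o adj incl.

End Compression.
Arguments compress {R H} L T.

Section SigmaMorphisms.
Variables (R : realType) (H K : hilbertType R).
Variables (A : set (H -> H)) (B : set (K -> K)).

Definition star_hom (f : (H -> H) -> (K -> K)) : Prop :=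
  [/\ forall S, A S -> B (f S),
      forall (c : R[i]) S T, A S -> A T -> f (c *: S + T) = c *: f S + f T,
      forall S T, A S -> A T -> f (S \o T) = f S \o f T &
      forall S, A S -> f (adj S) = adj (f S)].

Definition sigmastar_hom (f : (H -> H) -> (K -> K)) : Prop :=
  star_hom f /\
  forall (a : nat -> H -> H) T, (forall n, A (a n)) -> A T ->
    wot_cvg a T -> wot_cvg (fun n => f (a n)) (f T).

End SigmaMorphisms.

Definition sigmastar_iso (R : realType) (H K : hilbertType R)
    (A : set (H -> H)) (B : set (K -> K)) (f : (H -> H) -> (K -> K)) : Prop :=
  exists g : (K -> K) -> (H -> H),
    [/\ sigmastar_hom A B f, sigmastar_hom B A g,
        forall S, A S -> g (f S) = S & forall S, B S -> f (g S) = S].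

(* A C*-module is carried by a subspace X of a complex vector space V, with an
   action and an inner product whose values matter only on X and A: an abstract
   module is the case X = setT, a space of operators sits in V = (H1 -> H2). *)
Section Modules.
Variables (R : realType) (H : hilbertType R) (A : set (H -> H)).
Variables (V : lmodType R[i]) (X : set V).
Variables (act : V -> (H -> H) -> V) (ip : V -> V -> (H -> H)).

Definition positive_op (T : H -> H) : Prop := forall x, 0 <= inner x (T x).

Definition module_norm (x : V) : R := Num.sqrt (opnorm (ip x x)).

Definition module_action : Prop :=
  [/\ forall x a, X x -> A a -> X (act x a),
      forall (c : R[i]) x y a, X x -> X y -> A a ->
        act (c *: x + y) a = c *: act x a + act y a,
      forall (c : R[i]) x a b, X x -> A a -> A b ->
        act x (c *: a + b) = c *: act x a + act x b &
      forall x a b, X x -> A a -> A b -> act x (a \o b) = act (act x a) b].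

Definition module_inner_product : Prop :=
  [/\ forall x y, X x -> X y -> A (ip x y),
      forall (c : R[i]) x y z, X x -> X y -> X z ->
        ip x (c *: y + z) = c *: ip x y + ip x z,
      forall x y a, X x -> X y -> A a -> ip x (act y a) = ip x y \o a,
      forall x y, X x -> X y -> ip y x = adj (ip x y) &
      forall x, X x -> positive_op (ip x x) /\ (ip x x = 0 -> x = 0)].

Definition module_complete : Prop :=
  forall u : nat -> V, (forall n, X (u n)) ->
    (forall e : R, 0 < e -> exists N, forall m n, (N <= m)%N -> (N <= n)%N ->
      module_norm (u m - u n) < e) ->
    exists2 l, X l & module_norm (u n - l) @[n --> \oo] --> (0 : R).

Definition cstar_module : Prop :=
  [/\ cstar_algebra A, is_subspace X, module_action, module_inner_product &
      module_complete].

(* (K, t) is a realization of the Hilbert space completion of the algebraic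
   module tensor product of X and H over A, with t x h the elementary tensor: a
   linear map out of the algebraic tensor product is an A-balanced bilinear map,
   and here it is isometric with dense range.  The map x |-> t x is then the
   canonical embedding of X into B(H, K). *)
Definition interior_tensor (K : hilbertType R) (t : V -> H -> K) : Prop :=
  [/\ forall x (c : R[i]) h k, X x -> t x (c *: h + k) = c *: t x h + t x k,
      forall (c : R[i]) x y h, X x -> X y ->
        t (c *: x + y) h = c *: t x h + t y h,
      forall x a h, X x -> A a -> t (act x a) h = t x (a h),
      forall x y h k, X x -> X y ->
        inner (t x h) (t y k) = inner h (ip x y k) &
      acts_nondegenerately (t @` X)].

Definition sigmastar_module : Prop :=
  [/\ sigmastar_algebra A, cstar_module &
      exists (K : hilbertType R) (t : V -> H -> K),
        interior_tensor t /\ wot_seq_closed (t @` X)].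

End Modules.

(* The structure z . b = z b and <z1|z2> = z1^* z2 over an algebra of operators
   on the closed subspace L, through the identification made by [extend]. *)
Section OperatorModules.
Variables (R : realType) (H K : hilbertType R) (L : closed_subspace H).

Definition op_act (z : H -> K) (b : csub_type L -> csub_type L) : H -> K :=
  z \o extend b.

Definition op_ip (z1 z2 : H -> K) : csub_type L -> csub_type L :=
  compress L (adj z1 \o z2).

End OperatorModules.
Arguments op_act {R H K} L z b.
Arguments op_ip {R H K} L z1 z2.

(* Main.v *)
Require Import Defs.
From HB Require Import structures.
From mathcomp Require Import all_boot all_order all_algebra.
From mathcomp Require Import sesquilinear complex ring lra.
From mathcomp Require Import all_classical all_reals all_analysis.
Set Implicit Arguments.
Unset Strict Implicit.
Unset Printing Implicit Defensive.
Import Order.TTheory GRing.Theory Num.Theory.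
Import numFieldNormedType.Exports.
Local Open Scope classical_set_scope.
Local Open Scope ring_scope.
Local Open Scope complex_scope.

(** Everything is reduced to operators.  A module X over A that embeds in
    B(H, K) by an injective linear map r with r (x a) = (r x) a and
    <x|y> = (r x)^* (r y) satisfies all module axioms because operators do; its
    norm is the operator norm of r x by the C*-identity, so it is complete as
    soon as r X is WOT sequentially closed, and restricting the target to the
    closed span of r X H makes K the interior tensor product.  This is
    [sigmastar_module_of_operators], and it gives both direct constructions:

    - for a WOT sequentially closed TRO Z, the closure B of the span of Z^* Z
      is a *-algebra, because multiplication and adjunction are WOT
      sequentially continuous in each variable separately
      ([wot_seq_closure_star_algebra]), and Z B lies in Z because the operators
      b with Z b inside Z form a WOT sequentially closed set;
    - for a corner p D q, the required stability under products is algebra.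

    When the algebra lives on a proper closed subspace L, the same lemma is
    applied to z |-> z restricted to L; [compress_sigmastar] moves the algebra
    to L.

    Conversely, let X be a Sigma*-module over B, embedded by t in B(H, K).
    Since (t x)^* (t y) = <x|y>, the product (t x)(t y)^*(t z) is the image of
    x <y|z>, so t X is a TRO.  Sigma*-modules are defined by the existence of
    one realization with closed image, while the theorem speaks of every
    realization: elementary tensors have the same Gram matrix in all of them,
    so any two are intertwined by a unitary ([gram_isometry]), and composition
    with a unitary preserves WOT limits.

    For the last part, 2 x 2 matrices on H (+) K with entries in B, t X,
    (t X)^* and the algebra E of all operators on K that preserve t X together
    with their adjoints form a Sigma*-algebra C ([linking_sigmastar]): E absorbs
    (t X)(t X)^*, contains 1, and is WOT sequentially closed because t X is.
    The projection p onto H cuts out B as p C p and X as (1 - p) C p. *)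

(** * Inner products and real norms *)

Section ComplexRe.
Variable R : realType.

Lemma ReD (a b : R[i]) : complex.Re (a + b) = complex.Re a + complex.Re b.
Proof. by case: a; case: b. Qed.

Lemma ReN (a : R[i]) : complex.Re (- a) = - complex.Re a.
Proof. by case: a. Qed.

End ComplexRe.

Section InnerProduct.
Variables (R : realType) (H : hilbertType R).
Implicit Types (x y z : H) (c : R[i]).

Lemma innerC x y : inner y x = Num.conj (inner x y).
Proof. by rewrite /inner hermC expr0 mul1r. Qed.

Lemma innerPr c x y z : inner x (c *: y + z) = c * inner x y + inner x z.
Proof. exact: linearPl. Qed.

Lemma inner0r x : inner x 0 = 0.
Proof. exact: linear0l. Qed.

Lemma innerDr x y z : inner x (y + z) = inner x y + inner x z.
Proof. exact: linearDl. Qed.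

Lemma innerNr x y : inner x (- y) = - inner x y.
Proof. exact: linearNl. Qed.

Lemma innerBr x y z : inner x (y - z) = inner x y - inner x z.
Proof. exact: linearBl. Qed.

Lemma innerZr c x y : inner x (c *: y) = c * inner x y.
Proof. exact: linearZl_LR. Qed.

Lemma inner0l x : inner 0 x = 0.
Proof. exact: linear0r. Qed.

Lemma innerDl x y z : inner (y + z) x = inner y x + inner z x.
Proof. exact: linearDr. Qed.

Lemma innerNl x y : inner (- y) x = - inner y x.
Proof. exact: linearNr. Qed.

Lemma innerBl x y z : inner (y - z) x = inner y x - inner z x.
Proof. exact: linearBr. Qed.

Lemma innerZl c x y : inner (c *: y) x = Num.conj c * inner y x.
Proof. exact: linearZr_LR. Qed.

Lemma inner_eq0 x y : inner x y = 0 -> inner y x = 0.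
Proof. by move=> xy; rewrite innerC xy rmorph0. Qed.

Lemma inner_inj x y : (forall z, inner z x = inner z y) -> x = y.
Proof.
move=> xy; apply/eqP; rewrite -subr_eq0 -(dnorm_eq0 (dotp : {dot H for Num.conj})).
by rewrite -/(inner (x - y) (x - y)) innerBr xy subrr.
Qed.

(** The norm of a Hilbert space takes its values in R[i]; this is the same number
    in R, where the order is total and infima exist. *)
Definition nrm x : R := complex.Re `|x|.

Lemma nrmE x : `|x| = (nrm x)%:C.
Proof. by rewrite RRe_real// ger0_real. Qed.

Lemma nrm_ge0 x : 0 <= nrm x.
Proof. by rewrite -ler0c -nrmE. Qed.

Lemma nrm0 : nrm 0 = 0.
Proof. by rewrite /nrm normr0. Qed.

Lemma nrm_eq0 x : nrm x = 0 -> x = 0.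
Proof. by move=> x0; apply/eqP; rewrite -normr_eq0 nrmE x0. Qed.

Lemma nrmD x y : nrm (x + y) <= nrm x + nrm y.
Proof. by rewrite -lecR rmorphD /= -!nrmE ler_normD. Qed.

Lemma nrmN x : nrm (- x) = nrm x.
Proof. by rewrite /nrm normrN. Qed.

Lemma nrmB x y : nrm (x - y) = nrm (y - x).
Proof. by rewrite -nrmN opprB. Qed.

Lemma nrmZ (c : R) x : nrm (c%:C *: x) = `|c| * nrm x.
Proof.
apply: complexI; rewrite -nrmE normrZ nrmE rmorphM /=; congr (_ * _).
by rewrite normc_def /= expr0n/= addr0 sqrtr_sqr.
Qed.

Lemma sqr_nrm x : ((nrm x) ^+ 2)%:C = inner x x.
Proof. by rewrite /inner -sqr_norm_dotp nrmE rmorphXn. Qed.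

(** Pythagoras for the component of x orthogonal to y.  The left-hand side is
    nonnegative, which is the Cauchy-Schwarz inequality; it also shows that
    subtracting this component strictly shortens x unless x is orthogonal to y,
    which is the projection theorem. *)
Lemma sqr_norm_reject x y : y != 0 ->
  inner (x - (inner y x / inner y y) *: y) (x - (inner y x / inner y y) *: y) =
  inner x x - `|inner y x| ^+ 2 / inner y y.
Proof.
move=> y0; have yy0 : inner y y != 0.
  by rewrite -sqr_nrm -(rmorph0 (real_complex R)) (inj_eq (@complexI R))
    expf_eq0/=; apply: contraNneq y0 => /nrm_eq0 ->.
rewrite innerBr innerZr.
have -> : inner (x - (inner y x / inner y y) *: y) y = 0.
  apply: inner_eq0; rewrite innerBr innerZr divfK ?subrr//.
rewrite mulr0 subr0 innerBl innerZl normCK rmorphM /= fmorphV /= -[Num.conj (inner y y)]innerC.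
by congr (_ - _); field.
Qed.

Lemma cauchy_schwarz x y : `|inner x y| <= (nrm x * nrm y)%:C.
Proof.
rewrite -(ler_pXn2r (_ : (0 < 2)%N)) ?nnegrE// ?ler0c ?mulr_ge0 ?nrm_ge0//.
rewrite /= -[X in _ <= X]rmorphXn /= exprMn rmorphM /= !sqr_nrm.
have [->|x0] := eqVneq x 0; first by rewrite !inner0l normr0 expr0n mul0r.
rewrite mulrC -ler_pdivrMr; last first.
  by rewrite /inner dnorm_gt0.
rewrite -subr_ge0 -sqr_norm_reject// -sqr_nrm ler0c.
exact: sqr_ge0.
Qed.

Lemma inner_self_eq0 x : inner x x = 0 -> x = 0.
Proof.
by rewrite -sqr_nrm => /(@complexI R)/eqP; rewrite sqrf_eq0 => /eqP/nrm_eq0.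
Qed.

Lemma Re_inner_self x : complex.Re (inner x x) = nrm x ^+ 2.
Proof. by rewrite -sqr_nrm. Qed.

Lemma Re_innerC x y : complex.Re (inner y x) = complex.Re (inner x y).
Proof. by rewrite innerC; case: (inner x y). Qed.

Lemma parallelogram x y :
  nrm (x + y) ^+ 2 + nrm (x - y) ^+ 2 = 2 * nrm x ^+ 2 + 2 * nrm y ^+ 2.
Proof.
rewrite -!Re_inner_self !(innerDl, innerDr, innerNl, innerNr).
by rewrite !(ReD, ReN) (Re_innerC y x); ring.
Qed.

End InnerProduct.

(** * Convergence of sequences *)

Section ScalarConvergence.
Variable R : realType.
Implicit Types (a b : nat -> R[i]) (l m : R[i]).

Lemma cvgcP a l : a n @[n --> \oo] --> (l : R[i]^o) <->
  forall e : R, 0 < e ->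
    exists N, forall n, (N <= n)%N -> `|a n - l| < e%:C.
Proof.
split=> [ul e e0|ul].
  have e0' : 0 < e%:C by rewrite ltcR.
  move/(@cvgrPdist_lt _ R[i]^o): ul => /(_ _ e0') [N _ uN].
  by exists N => n Nn; have := uN n Nn; rewrite /= distrC.
apply/(@cvgrPdist_lt _ R[i]^o) => e e0.
have [r re] : exists r : R, e = r%:C by apply/complex_realP/gtr0_real.
move: e0; rewrite re ltcR => r0; have [N uN] := ul _ r0.
by exists N => // n Nn; rewrite /= distrC uN.
Qed.

Lemma cvgc_unique a l m : a n @[n --> \oo] --> (l : R[i]^o) ->
  a n @[n --> \oo] --> (m : R[i]^o) -> l = m.
Proof. by move=> al am; exact: (@norm_cvg_unique _ R[i]^o _ _ _ _ al am). Qed.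

Lemma cvgcD a b l m : a n @[n --> \oo] --> (l : R[i]^o) ->
  b n @[n --> \oo] --> (m : R[i]^o) ->
  (a n + b n) @[n --> \oo] --> (l + m : R[i]^o).
Proof. by move=> al bm; exact: (@cvgD _ R[i]^o _ _ _ _ _ _ _ al bm). Qed.

Lemma cvgcM c a l : a n @[n --> \oo] --> (l : R[i]^o) ->
  (c * a n) @[n --> \oo] --> (c * l : R[i]^o).
Proof. by move=> al; exact: (@cvgZl_tmp _ R[i]^o _ _ _ c _ _ al). Qed.

Lemma cvgc_conj a l : a n @[n --> \oo] --> (l : R[i]^o) ->
  Num.conj (a n) @[n --> \oo] --> (Num.conj l : R[i]^o).
Proof.
move=> /cvgcP al; apply/cvgcP => e /al [N aN]; exists N => n /aN.
by rewrite -rmorphB norm_conjC.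
Qed.

End ScalarConvergence.

Section Convergence.
Variables (R : realType) (H : hilbertType R).
Implicit Types (x y z : H) (c : R[i]).

Lemma cvgn_nrmP (u : nat -> H) l :
  u @ \oo --> l <-> forall e : R, 0 < e ->
    exists N, forall n, (N <= n)%N -> nrm (u n - l) < e.
Proof.
split=> [ul e e0|ul].
  have e0' : 0 < e%:C by rewrite ltcR.
  move/cvgrPdist_lt: ul => /(_ _ e0') [N _ uN].
  by exists N => n Nn; have := uN n Nn; rewrite /= distrC nrmE ltcR.
apply/cvgrPdist_lt => e e0.
have [r re] : exists r : R, e = r%:C by apply/complex_realP/gtr0_real.
move: e0; rewrite re ltcR => r0; have [N uN] := ul _ r0.
by exists N => // n Nn; rewrite /= distrC nrmE ltcR uN.
Qed.

Lemma hilbert_complete (u : nat -> H) :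
  (forall e : R, 0 < e -> exists N, forall m n, (N <= m)%N -> (N <= n)%N ->
     nrm (u m - u n) < e) ->
  exists l : H, u @ \oo --> l.
Proof.
move=> uc; apply/cvg_ex; apply: cauchy_cvg; apply/cauchy_ballP => e e0.
have [r re] : exists r : R, e = r%:C by apply/complex_realP/gtr0_real.
move: e0; rewrite re ltcR => r0; have [N uN] := uc _ r0.
exists (u @` [set n | (N <= n)%N], u @` [set n | (N <= n)%N]) => /=.
  by split; exists N => // n /= Nn; exists n.
move=> [_ _] [/= [m Nm <-] [n Nn <-]].
by rewrite -ball_normE /= nrmE ltcR uN.
Qed.

Lemma inner_cvgr (u : nat -> H) l y :
  u @ \oo --> l -> inner y (u n) @[n --> \oo] --> (inner y l : R[i]^o).
Proof.
move=> ul; apply/cvgcP => r r0.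
have y0 : 0 < nrm y + 1 by rewrite ltr_wpDl// nrm_ge0.
have [N uN] := (cvgn_nrmP u l).1 ul _ (divr_gt0 r0 y0).
exists N => n /uN; rewrite ltr_pdivlMr// => un.
rewrite -innerBr; apply: (le_lt_trans (cauchy_schwarz _ _)); rewrite ltcR.
apply: le_lt_trans un.
by rewrite mulrC ler_wpM2l ?nrm_ge0// lerDl.
Qed.

Lemma closure_cvgn (A : set H) x : closure A x ->
  exists2 u : nat -> H, (forall n, A (u n)) & u @ \oo --> x.
Proof.
move=> Ax.
have Bx n : exists y, A y /\ nrm (y - x) < n.+1%:R^-1.
  have n0 : 0 < (n.+1%:R^-1 : R)%:C by rewrite ltcR invr_gt0 ltr0n.
  have [y [Ay]] := Ax _ (nbhsx_ballx x _ n0).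
  by rewrite -ball_normE /= distrC nrmE ltcR; exists y.
have [u uP] := choice Bx; exists u; first by move=> n; have [] := uP n.
apply/cvgn_nrmP => e e0; have [N _ eN] := near_infty_natSinv_lt (PosNum e0).
exists N => n Nn; apply: lt_trans (eN n Nn); by have [] := uP n.
Qed.

Lemma closed_cvgn (A : set H) :
  (forall (u : nat -> H) l, (forall n, A (u n)) -> u @ \oo --> l -> A l) ->
  closed A.
Proof. by move=> Acl x /closure_cvgn [u Au ux]; exact: Acl Au ux. Qed.

Lemma closed_orth y : closed [set x | inner y x = 0].
Proof.
apply: closed_cvgn => u l uy ul.
apply: (cvgc_unique (inner_cvgr (y := y) ul)); apply/cvgcP => e e0.
by exists 0%N => n _; rewrite (uy n) subrr normr0 ltcR.
Qed.

End Convergence.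

(** * The projection theorem *)

Section Projection.
Variables (R : realType) (H : hilbertType R).
Implicit Types (L : closed_subspace H) (x y z : H) (S : set H).

Lemma csub0 L : csub_set L 0.
Proof. by have [] := csub_subspace L. Qed.

Lemma csubP L c x y : csub_set L x -> csub_set L y -> csub_set L (c *: x + y).
Proof. by have [_] := csub_subspace L; apply. Qed.

Lemma csubZ L c x : csub_set L x -> csub_set L (c *: x).
Proof. by move=> Lx; rewrite -[_ *: _]addr0; apply: csubP => //; apply: csub0. Qed.

Lemma csubD L x y : csub_set L x -> csub_set L y -> csub_set L (x + y).
Proof. by rewrite -[X in X + y]scale1r; apply: csubP. Qed.

Lemma csub_cvgn L (u : nat -> H) l :
  (forall n, csub_set L (u n)) -> u @ \oo --> l -> csub_set L l.
Proof.
move=> Lu ul; apply: (csub_closed (c := L)) => B /ul [N _ uN].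
by exists (u N); split => //; apply: uN => /=.
Qed.

(** A minimizing sequence is Cauchy by the parallelogram identity, because the
    midpoint of two of its terms lies in L again. *)
Lemma nearest_point L x : exists2 p, csub_set L p &
  forall y, csub_set L y -> nrm (x - p) <= nrm (x - y).
Proof.
pose D : set R := [set nrm (x - y) ^+ 2 | y in csub_set L].
have Dinf : has_inf D.
  split; first by exists (nrm (x - 0) ^+ 2), 0 => //; apply: csub0.
  by exists 0 => _ [y _ <-]; exact: sqr_ge0.
pose d := inf D.
have dle y : csub_set L y -> d <= nrm (x - y) ^+ 2.
  by move=> Ly; apply: ge_inf; [case: Dinf|exists y].
have near n : exists y, csub_set L y /\ nrm (x - y) ^+ 2 < d + n.+1%:R^-1.
  have n0 : 0 < n.+1%:R^-1 :> R by rewrite invr_gt0 ltr0n.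
  by have [_ [y Ly <-] yd] := inf_adherent n0 Dinf; exists y.
have [u uP] := choice near.
have mid m n : nrm (u m - u n) ^+ 2 <= 2 * m.+1%:R^-1 + 2 * n.+1%:R^-1.
  have [Lm um] := uP m; have [Ln un] := uP n.
  have := parallelogram (x - u m) (x - u n).
  have -> : x - u m - (x - u n) = u n - u m by rewrite opprB addrC addrA subrK.
  (* The sum is twice the distance vector to the midpoint, which is in L. *)
  have -> : x - u m + (x - u n) =
      (2%:R : R)%:C *: (x - ((2%:R : R)^-1)%:C *: (u m + u n)).
    rewrite scalerBr scalerA -rmorphM /= mulfV ?pnatr_eq0// scale1r.
    by rewrite opprD addrACA -opprD rmorph_nat scaler_nat mulr2n opprD.
  rewrite nrmZ exprMn real_normK ?num_real// (nrmB (u m)).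
  have := dle _ (csubZ ((2%:R : R)^-1)%:C (csubD Lm Ln)).
  by move: m.+1%:R^-1 n.+1%:R^-1 um un => a b; lra.
have [p up] : exists p : H, u @ \oo --> p.
  apply: hilbert_complete => e e0.
  have e4 : 0 < e ^+ 2 / 4 by rewrite divr_gt0// exprn_gt0.
  have [N _ eN] := near_infty_natSinv_lt (PosNum e4).
  exists N => m n /eN /= em /eN /= en.
  rewrite -(ltr_pXn2r (_ : (0 < 2)%N)) ?nnegrE ?nrm_ge0 ?(ltW e0)//.
  by move: (mid m n) em en; move: m.+1%:R^-1 n.+1%:R^-1 => a b; lra.
have Lp := csub_cvgn (fun n => (uP n).1) up.
exists p => // y /dle yd.
rewrite leNgt; apply/negP => yp.
pose e := (nrm (x - p) - nrm (x - y)) / 2.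
have e0 : 0 < e by rewrite divr_gt0// subr_gt0.
have [N uN] := (cvgn_nrmP u p).1 up _ e0.
have [M _ eM] := near_infty_natSinv_lt (PosNum (exprn_gt0 2 e0)).
pose n := maxn N M; have /= en := eM n (leq_maxr _ _).
have un := uN n (leq_maxl _ _); have [_ dn] := uP n.
have tri : nrm (x - p) <= nrm (x - u n) + nrm (u n - p).
  by apply: le_trans (nrmD _ _); rewrite addrA subrK.
have eE : nrm (x - p) = nrm (x - y) + 2 * e by rewrite /e; field.
have := nrm_ge0 (x - y); have := nrm_ge0 (x - u n).
move: yd dn en un tri eE (e0).
move: (nrm (x - p)) (nrm (x - y)) (nrm (x - u n)) (nrm (u n - p)).
move: n.+1%:R^-1 (d) (e).
move=> g h k a b c f bd ch ge fe acf ab k0 c0 b0.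
have bc : b + k < c by lra.
have : (b + k) * (b + k) <= c * c by apply: ler_pM; lra.
by have := mulr_ge0 b0 (ltW k0); rewrite mulrDl !mulrDr; lra.
Qed.

(** Otherwise the nearest point could be moved along y to come strictly nearer,
    by the identity [sqr_norm_reject]. *)
Lemma projection_theorem L x : exists2 p, csub_set L p &
  forall y, csub_set L y -> inner y (x - p) = 0.
Proof.
have [p Lp px] := nearest_point L x; exists p => // y Ly.
have [->|y0] := eqVneq y 0; first by rewrite inner0l.
have /px := csubD Lp (csubZ (inner y (x - p) / inner y y) Ly).
rewrite opprD addrA -(ler_pXn2r (_ : (0 < 2)%N)) ?nnegrE ?nrm_ge0//.
rewrite -lecR !sqr_nrm sqr_norm_reject// lerBrDl gerDr.
rewrite pmulr_lle0 ?invr_gt0 /inner ?dnorm_gt0// => h.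
have : `|dotp (x - p) y| ^+ 2 = 0 by apply/eqP; rewrite eq_le h exprn_ge0.
by move/eqP; rewrite expf_eq0 normr_eq0 => /eqP.
Qed.

Lemma lspan_sub (V : lmodType R[i]) (S : set V) : S `<=` lspan S.
Proof. by move=> x Sx A [_]; apply. Qed.

Lemma lspan_min (V : lmodType R[i]) (S A : set V) :
  is_subspace A -> S `<=` A -> lspan S `<=` A.
Proof. by move=> sA SA x; apply. Qed.

Lemma closed_span_sub S : S `<=` csub_set (closed_span S).
Proof. by move=> x /lspan_sub/subset_closure. Qed.

Lemma closed_span_min S L : S `<=` csub_set L ->
  csub_set (closed_span S) `<=` csub_set L.
Proof.
move=> SL x /closure_cvgn[u Su ux]; apply: csub_cvgn ux => n.
exact: lspan_min (csub_subspace L) SL _ (Su n).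
Qed.

Definition orth_compl S : closed_subspace H.
Proof.
apply: (@ClosedSubspace _ _ [set x | forall y, S y -> inner y x = 0]).
- split=> [y _|c x y Sx Sy z Sz]; first exact: inner0r.
  by rewrite innerPr Sx// Sy// mulr0 addr0.
- apply: closed_cvgn => u l Su ul y Sy.
  apply: closed_orth => B /ul [N _ uN].
  by exists (u N); split; [exact: Su|apply: uN => /=].
Defined.

(** A proper closed span misses some x, and x minus its projection is a nonzero
    vector orthogonal to S.  All density statements below go through this
    criterion. *)
Lemma closed_spanT S :
  (forall x, (forall y, S y -> inner y x = 0) -> x = 0) <->
  csub_set (closed_span S) = setT.
Proof.
split=> [S0|ST x Sx].
  apply/seteqP; split=> // x _.
  have [p Lp xp] := projection_theorem (closed_span S) x.
  have /eqP : x - p = 0 by apply: S0 => y Sy; apply/xp/closed_span_sub.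
  by rewrite subr_eq0 => /eqP ->.
pose L := orth_compl [set x].
have /(closed_span_min (L := L)) : S `<=` csub_set L.
  by move=> y Sy _ -> /=; apply: inner_eq0; exact: Sx.
by rewrite ST => /(_ x I x erefl) xx; exact: inner_self_eq0.
Qed.

End Projection.

(** * Bounded operators and their adjoints *)

Section BoundedOperators.
Variables (R : realType).
Implicit Types (H K L : hilbertType R).

Lemma normc_real (c : R[i]) : exists2 r : R, 0 <= r & `|c| = r%:C.
Proof.
have [r rE] : exists r : R, `|c| = r%:C by apply/complex_realP/ger0_real.
by exists r; rewrite // -ler0c -rE.
Qed.

Lemma bounded_opsP H K (T : H -> K) : bounded_ops T <->
  linear T /\ exists2 M : R, 0 <= M & forall x, nrm (T x) <= M * nrm x.
Proof.
split=> [[Tl Tc]|[Tl [M M0 TM]]]; split => //.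
  pose f : {linear H -> K} := HB.pack T (GRing.isLinear.Build _ _ _ _ T Tl).
  have /linear_boundedP/pinfty_ex_gt0[r r0 fr] : bounded_near f (nbhs (0 : H)).
    exact/linear_bounded_continuous.
  have [s rs] : exists s : R, r = s%:C by apply/complex_realP/gtr0_real.
  exists s => [|x]; first by rewrite -ler0c -rs ltW.
  by rewrite -lecR rmorphM /= -!nrmE -rs; exact: fr.
pose f : {linear H -> K} := HB.pack T (GRing.isLinear.Build _ _ _ _ T Tl).
suff : bounded_near f (nbhs (0 : H)) by move/linear_bounded_continuous.
apply/linear_boundedP; exists M%:C; split; first by rewrite ger0_real// ler0c.
move=> r Mr x; rewrite (le_trans (y := M%:C * `|x|))//.
  by rewrite !nrmE -rmorphM lecR; exact: TM.
by rewrite ler_wpM2r// ltW.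
Qed.

Lemma bounded_linear H K (T : H -> K) : bounded_ops T -> linear T.
Proof. by case. Qed.

Lemma op0 H K (T : H -> K) : linear T -> T 0 = 0.
Proof. by move=> Tl; have := Tl (-1) 0 0; rewrite scaler0 addr0 scaleN1r addNr. Qed.

Lemma opD H K (T : H -> K) x y : linear T -> T (x + y) = T x + T y.
Proof. by move=> Tl; have := Tl 1 x y; rewrite !scale1r. Qed.

Lemma opZ H K (T : H -> K) c x : linear T -> T (c *: x) = c *: T x.
Proof. by move=> Tl; have := Tl c x 0; rewrite (op0 Tl) !addr0. Qed.

Lemma opB H K (T : H -> K) x y : linear T -> T (x - y) = T x - T y.
Proof. by move=> Tl; rewrite opD// -scaleN1r opZ// scaleN1r. Qed.

Lemma bounded_comp H K L (S : K -> L) (T : H -> K) :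
  bounded_ops S -> bounded_ops T -> bounded_ops (S \o T).
Proof.
move=> [Sl Sc] [Tl Tc]; split; first by move=> c x y; rewrite /= Tl Sl.
by move=> x; apply: continuous_comp; [exact: Tc|exact: Sc].
Qed.

Lemma bounded_subspace H K : is_subspace (@bounded_ops R H K).
Proof.
split; first by split=> [c x y|]; [rewrite scaler0 addr0|exact: cst_continuous].
move=> c S T /bounded_opsP[Sl [M M0 SM]] /bounded_opsP[Tl [N N0 TN]].
apply/bounded_opsP; split.
  move=> d x y; rewrite -[LHS]/(c *: S (d *: x + y) + T (d *: x + y)).
  rewrite -[RHS]/(d *: (c *: S x + T x) + (c *: S y + T y)) Sl Tl.
  by rewrite !scalerDr !scalerA (mulrC c) addrACA.
have [r r0 cr] := normc_real c.
exists (r * M + N) => [|x]; first by rewrite addr_ge0// mulr_ge0.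
rewrite -[(c *: S + T) x]/(c *: S x + T x) (le_trans (nrmD _ _))// mulrDl lerD//.
have -> : nrm (c *: S x) = r * nrm (S x).
  by apply: complexI; rewrite -nrmE normrZ rmorphM /= -nrmE cr.
by rewrite -mulrA ler_wpM2l.
Qed.

Lemma bounded_id H : bounded_ops (@idfun H).
Proof. by split=> // x; exact: cvg_id. Qed.

Lemma is_subspaceD (V : lmodType R[i]) (A : set V) x y :
  is_subspace A -> A x -> A y -> A (x + y).
Proof. by move=> [_ AD] Ax Ay; rewrite -[x]scale1r; apply: AD. Qed.

Lemma is_subspaceB (V : lmodType R[i]) (A : set V) x y :
  is_subspace A -> A x -> A y -> A (x - y).
Proof. by move=> [A0 AD] Ax Ay; rewrite addrC -scaleN1r; apply: AD. Qed.

(** The kernel of a nonzero bounded functional is a proper closed subspace, and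
    a vector z orthogonal to it represents f up to a scalar, since
    f z *: x - f x *: z is in the kernel. *)
Lemma riesz H (f : H -> R[i]) (M : R) :
  (forall c x y, f (c *: x + y) = c * f x + f y) ->
  (forall x, `|f x| <= (M * nrm x)%:C) ->
  exists y, forall x, f x = inner y x.
Proof.
move=> fl fM.
have f0 : f 0 = 0.
  by have := fl (-1) 0 0; rewrite scaler0 addr0 mulN1r addNr.
have fB x y : f (x - y) = f x - f y.
  by rewrite addrC -scaleN1r fl mulN1r addrC.
have [f00|/existsNP[x0 fx0]] := pselect (forall x, f x = 0).
  by exists 0 => x; rewrite f00 inner0l.
have Nsub : is_subspace [set x | f x = 0].
  by split=> //= c x y fx fy; rewrite fl fx fy mulr0 addr0.
have Ncl : closed [set x | f x = 0].
  apply: closed_cvgn => u l fu ul /=.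
  apply/normr0_eq0/eqP; rewrite eq_le normr_ge0 andbT.
  have M0 : 0 <= M.
    rewrite leNgt; apply/negP => M0; apply: fx0; apply/normr0_eq0/eqP.
    rewrite eq_le normr_ge0 andbT (le_trans (fM _))// lecR.
    by rewrite mulr_le0_ge0 ?nrm_ge0// ltW.
  have M1 : 0 < M + 1 by rewrite ltr_wpDl.
  have [r _ re] := normc_real (f l).
  rewrite re lecR; apply/ler_addgt0Pr => e e0; rewrite add0r.
  have [N uN] := (cvgn_nrmP u l).1 ul _ (divr_gt0 e0 M1).
  have := uN N (leqnn _); rewrite ltr_pdivlMr// => un.
  have : `|f l| <= (M * nrm (l - u N))%:C.
    by rewrite -[f l]subr0 -[X in _ - X](fu N : f (u N) = 0) -fB fM.
  rewrite re lecR nrmB => /le_trans; apply; apply: le_trans (ltW un).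
  by rewrite mulrC ler_wpM2l ?nrm_ge0// lerDl.
have [p fp px] := projection_theorem (ClosedSubspace Nsub Ncl) x0.
pose z := x0 - p; have fz : f z <> 0 by rewrite /z fB fp subr0.
have zz : inner z z != 0.
  rewrite /inner dnorm_eq0; apply/eqP => z0; apply: fz.
  by rewrite z0.
exists (Num.conj (f z / inner z z) *: z) => x.
have : inner (f z *: x - f x *: z) z = 0.
  apply: px => /=; rewrite addrC -scaleNr fl.
  by rewrite -[_ *: x]addr0 fl f0 addr0 mulNr mulrC addNr.
move=> /inner_eq0; rewrite innerBr !innerZr innerZl conjCK => /eqP.
rewrite subr_eq0 => /eqP fzx.
by rewrite mulrAC fzx mulfK.
Qed.

Lemma adj_exists H K (T : H -> K) : bounded_ops T ->
  exists S, forall x y, inner (T x) y = inner x (S y).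
Proof.
move=> /bounded_opsP[Tl [M M0 TM]].
have ex y : exists s, forall x, inner y (T x) = inner s x.
  apply: (@riesz H (fun x => inner y (T x)) (nrm y * M)).
    by move=> c a b; rewrite Tl innerPr.
  move=> x; rewrite (le_trans (cauchy_schwarz _ _))// lecR -mulrA.
  by rewrite ler_wpM2l// nrm_ge0.
have [S SP] := choice ex; exists S => x y.
by rewrite innerC SP -innerC.
Qed.

(** Adjoints are always computed through this lemma: exhibiting one S with the
    defining property avoids the default value in the definition of [adj]. *)
Lemma adj_unique H K (T : H -> K) S :
  (forall x y, inner (T x) y = inner x (S y)) -> adj T = S.
Proof.
move=> TS; have : [set S | forall x y, inner (T x) y = inner x (S y)] (adj T).
  by apply: xgetPex; exists S.
by move=> /= TA; apply/funext => y; apply: inner_inj => x; rewrite -TA TS.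
Qed.

Lemma adjP H K (T : H -> K) x y : bounded_ops T ->
  inner (T x) y = inner x (adj T y).
Proof. by move=> /adj_exists[S TS]; rewrite (adj_unique TS). Qed.

Lemma adjPr H K (T : H -> K) x y : bounded_ops T ->
  inner y (T x) = inner (adj T y) x.
Proof. by move=> Tb; rewrite innerC adjP// -innerC. Qed.

(** |T^* y|^2 = <T T^* y, y> is at most M |T^* y| |y|. *)
Lemma nrm_adj_le H K (T : H -> K) M : 0 <= M -> bounded_ops T ->
  (forall x, nrm (T x) <= M * nrm x) -> forall y, nrm (adj T y) <= M * nrm y.
Proof.
move=> M0 Tb TM y; have [->|y0] := eqVneq (adj T y) 0.
  by rewrite nrm0 mulr_ge0 ?nrm_ge0.
have s0 : 0 < nrm (adj T y).
  by rewrite lt_neqAle nrm_ge0 andbT eq_sym; apply: contra_neq y0 => /nrm_eq0.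
rewrite -(ler_pM2r s0) -expr2.
rewrite -lecR sqr_nrm -adjP// -[X in X <= _]ger0_norm; last first.
  by rewrite adjP// /inner dnorm_ge0.
apply: le_trans (cauchy_schwarz _ _) _; rewrite lecR.
by rewrite mulrAC ler_wpM2r ?nrm_ge0.
Qed.

Lemma adj_bounded H K (T : H -> K) : bounded_ops T -> bounded_ops (adj T).
Proof.
move=> Tb; have /bounded_opsP[Tl [M M0 TM]] := Tb.
apply/bounded_opsP; split=> [c x y|]; last by exists M => //; exact: nrm_adj_le.
by apply: inner_inj => z; rewrite innerPr -!adjP// innerPr.
Qed.

Lemma adjK H K (T : H -> K) : bounded_ops T -> adj (adj T) = T.
Proof. by move=> Tb; apply: adj_unique => x y; rewrite -adjPr. Qed.

Lemma adj_comp H K L (S : K -> L) (T : H -> K) :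
  bounded_ops S -> bounded_ops T -> adj (S \o T) = adj T \o adj S.
Proof. by move=> Sb Tb; apply: adj_unique => x y /=; rewrite !adjP. Qed.

Lemma adj_lincomb H K c (S T : H -> K) : bounded_ops S -> bounded_ops T ->
  adj (c *: S + T) = Num.conj c *: adj S + adj T.
Proof.
move=> Sb Tb; apply: adj_unique => x y.
rewrite -[(c *: S + T) x]/(c *: S x + T x).
rewrite -[(_ + _ : K -> H) y]/(Num.conj c *: adj S y + adj T y).
by rewrite innerDl innerDr innerZl innerZr !adjP.
Qed.

Lemma adj_id H : adj (@idfun H) = idfun.
Proof. exact: adj_unique. Qed.

Section OperatorNorm.
Variables (H K : hilbertType R).
Implicit Types S T : H -> K.

Let unit_values T : set R :=
  [set complex.Re `|T x| | x in [set x : H | `|x| <= 1]].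

Lemma opnorm_has_sup T : bounded_ops T -> has_sup (unit_values T).
Proof.
move=> /bounded_opsP[Tl [M M0 TM]]; split.
  by exists (nrm (T 0)), 0 => //=; rewrite normr0.
exists M => _ [x /= x1 <-]; rewrite (le_trans (TM x))//.
by rewrite ler_piMr// -lecR -nrmE.
Qed.

Lemma opnorm_ge0 T : bounded_ops T -> 0 <= opnorm T.
Proof.
move=> Tb; apply: (le_trans (nrm_ge0 (T 0))).
apply: ub_le_sup; first by case: (opnorm_has_sup Tb).
by exists 0 => //=; rewrite normr0.
Qed.

Lemma opnormP T x : bounded_ops T -> nrm (T x) <= opnorm T * nrm x.
Proof.
move=> Tb; have Tl := bounded_linear Tb.
have [->|x0] := eqVneq x 0; first by rewrite op0// !nrm0 mulr0.
have x1 : 0 < nrm x.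
  by rewrite lt_neqAle nrm_ge0 andbT eq_sym; apply: contra_neq x0 => /nrm_eq0.
rewrite -ler_pdivrMr//.
have -> : nrm (T x) / nrm x = nrm (T ((nrm x)^-1%:C *: x)).
  by rewrite opZ// nrmZ ger0_norm ?invr_ge0 ?nrm_ge0// mulrC.
apply: ub_le_sup; first by case: (opnorm_has_sup Tb).
exists ((nrm x)^-1%:C *: x) => //=.
by rewrite nrmE lecR nrmZ ger0_norm ?invr_ge0 ?nrm_ge0// mulVf// gt_eqF.
Qed.

Lemma opnorm_le T M : bounded_ops T -> 0 <= M ->
  (forall x, nrm (T x) <= M * nrm x) -> opnorm T <= M.
Proof.
move=> Tb M0 TM; apply: ge_sup; first by case: (opnorm_has_sup Tb).
move=> _ [x /= x1 <-]; rewrite (le_trans (TM x))//.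
by rewrite ler_piMr// -lecR -nrmE.
Qed.

End OperatorNorm.

(** The nontrivial inequality comes from |T x|^2 = <x, T^* T x>. *)
Lemma cstar_identity H K (T : H -> K) : bounded_ops T ->
  opnorm (adj T \o T) = opnorm T ^+ 2.
Proof.
move=> Tb; have Ab := adj_bounded Tb; have ATb := bounded_comp Ab Tb.
have T0 := opnorm_ge0 Tb; have AT0 := opnorm_ge0 ATb.
apply/eqP; rewrite eq_le; apply/andP; split.
  apply: opnorm_le => // [|x /=]; first exact: sqr_ge0.
  rewrite (le_trans (nrm_adj_le T0 Tb (fun x => opnormP x Tb) _))//.
  by rewrite expr2 -mulrA ler_wpM2l// opnormP.
rewrite -[X in _ <= X]sqr_sqrtr// ler_pXn2r// ?nnegrE ?sqrtr_ge0//.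
apply: opnorm_le => //.
move=> x; rewrite -(ler_pXn2r (_ : (0 < 2)%N)) ?nnegrE ?mulr_ge0 ?nrm_ge0 ?sqrtr_ge0//.
rewrite exprMn sqr_sqrtr// -lecR sqr_nrm adjP// -[X in X <= _]ger0_norm; last first.
  by rewrite -adjP// /inner dnorm_ge0.
apply: le_trans (cauchy_schwarz _ _) _; rewrite lecR expr2 mulrCA.
by rewrite ler_wpM2l ?nrm_ge0//; exact: (opnormP x ATb).
Qed.


(** * Weak operator convergence *)

Section WeakOperatorTopology.
Variables (H K : hilbertType R).
Implicit Types (S T : H -> K) (a b : nat -> H -> K) (A : set (H -> K)).

Lemma wot_unique a S T : wot_cvg a S -> wot_cvg a T -> S = T.
Proof.
move=> aS aT; apply/funext => x; apply: inner_inj => y.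
exact: cvgc_unique (aS x y) (aT x y).
Qed.

Lemma wot_cst T : wot_cvg (fun=> T) T.
Proof. by move=> x y; exact: (@cvg_cst R[i]^o). Qed.

Lemma wot_lincomb c a b S T : wot_cvg a S -> wot_cvg b T ->
  wot_cvg (fun n => c *: a n + b n) (c *: S + T).
Proof.
move=> aS bT x y; have := cvgcD (cvgcM (c := c) (aS x y)) (bT x y).
by rewrite -innerPr; under eq_cvg do rewrite -innerPr.
Qed.

Lemma wot_adj a T : (forall n, bounded_ops (a n)) -> bounded_ops T ->
  wot_cvg a T -> wot_cvg (fun n => adj (a n)) (adj T).
Proof.
move=> ab Tb aT x y; rewrite -adjP// innerC.
have := cvgc_conj (aT y x).
by under eq_cvg do rewrite -innerC adjP//.
Qed.

Lemma wot_opnorm a T : (forall n, bounded_ops (a n)) -> bounded_ops T ->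
  opnorm (a n - T) @[n --> \oo] --> (0 : R) -> wot_cvg a T.
Proof.
move=> ab Tb aT x y; apply: inner_cvgr; apply/cvgn_nrmP => e e0.
have x0 : 0 < nrm x + 1 by rewrite ltr_wpDl// nrm_ge0.
move/cvgrPdist_lt: aT => /(_ _ (divr_gt0 e0 x0)) [N _ aN].
exists N => n /aN; rewrite /= sub0r normrN ltr_pdivlMr// => an.
have dbd : bounded_ops (a n - T) by apply: is_subspaceB => //; exact: bounded_subspace.
rewrite ger0_norm ?opnorm_ge0// in an.
rewrite (le_lt_trans (opnormP x dbd))//; apply: le_lt_trans an.
by rewrite ler_wpM2l ?opnorm_ge0// lerDl.
Qed.

(** The norm limit of a Cauchy sequence of operators exists pointwise, and the
    Cauchy estimate passes to the limit uniformly on the unit ball. *)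
Lemma bounded_ops_complete a : (forall n, bounded_ops (a n)) ->
  (forall e : R, 0 < e -> exists N, forall m n, (N <= m)%N -> (N <= n)%N ->
      opnorm (a m - a n) < e) ->
  exists2 T, bounded_ops T & opnorm (a n - T) @[n --> \oo] --> (0 : R).
Proof.
move=> ab ac.
have dbd S T : bounded_ops S -> bounded_ops T -> bounded_ops (S - T).
  by move=> Sb Tb; apply: is_subspaceB => //; exact: bounded_subspace.
have lim x : exists l : K, a n x @[n --> \oo] --> l.
  apply: hilbert_complete => e e0.
  have x0 : 0 < nrm x + 1 by rewrite ltr_wpDl// nrm_ge0.
  have [N aN] := ac _ (divr_gt0 e0 x0).
  exists N => m n Nm Nn; have := aN m n Nm Nn; rewrite ltr_pdivlMr//.
  apply: le_lt_trans; apply: le_trans (opnormP x (dbd _ _ (ab m) (ab n))) _.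
  by rewrite ler_wpM2l ?opnorm_ge0// ?lerDl//; exact: dbd.
have [T TP] := choice lim.
have est e : 0 < e -> exists N, forall n, (N <= n)%N ->
    forall x, nrm (a n x - T x) <= e * nrm x.
  move=> e0; have [N aN] := ac _ e0; exists N => n Nn x.
  apply/ler_addgt0Pr => d d0; have [M TM] := (cvgn_nrmP _ _).1 (TP x) _ d0.
  pose m := maxn N M; have Nm : (N <= m)%N by rewrite leq_maxl.
  have -> : a n x - T x = (a n - a m) x + (a m x - T x).
    by rewrite -[(a n - a m) x]/(a n x - a m x) addrA subrK.
  rewrite (le_trans (nrmD _ _))// lerD ?(ltW (TM m (leq_maxr _ _)))//.
  rewrite (le_trans (opnormP x (dbd _ _ (ab n) (ab m))))//.
  by rewrite ler_wpM2r ?nrm_ge0// ltW// aN.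
have Tl : linear T.
  move=> c x y; apply: inner_inj => z; rewrite innerPr.
  apply: (cvgc_unique (inner_cvgr (y := z) (TP (c *: x + y)))).
  have := cvgcD (cvgcM (c := c) (inner_cvgr (y := z) (TP x))) (inner_cvgr (y := z) (TP y)).
  by under eq_cvg do rewrite -innerPr -(bounded_linear (ab _)).
have Tb : bounded_ops T.
  have [N /(_ N (leqnn N)) TN] := est _ ltr01.
  apply/bounded_opsP; split => //; exists (opnorm (a N) + 1) => [|x].
    by rewrite addr_ge0// opnorm_ge0.
  have -> : T x = a N x - (a N x - T x) by rewrite opprB addrC subrK.
  by rewrite (le_trans (nrmD _ _))// nrmN mulrDl lerD// opnormP.
exists T => //; apply/cvgrPdist_le => e e0; have [N aN] := est _ e0.
exists N => // n /= Nn; rewrite sub0r normrN ger0_norm ?opnorm_ge0//; last exact: dbd.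
by apply: opnorm_le (ltW e0) _; [exact: dbd|exact: aN].
Qed.

End WeakOperatorTopology.

Lemma wot_compl H K L (S : K -> L) (a : nat -> H -> K) T :
  bounded_ops S -> wot_cvg a T -> wot_cvg (fun n => S \o a n) (S \o T).
Proof.
move=> Sb aT x y; have := aT x (adj S y); rewrite -adjPr//.
by under eq_cvg do rewrite -adjPr//.
Qed.

Lemma wot_compr H K L (S : H -> K) (a : nat -> K -> L) T :
  wot_cvg a T -> wot_cvg (fun n => a n \o S) (T \o S).
Proof. by move=> aT x y; exact: aT. Qed.

Lemma wot_seq_closed_norm_closed H (A : set (H -> H)) :
  A `<=` @bounded_ops R H H -> wot_seq_closed A -> norm_closed A.
Proof.
move=> Ab Acl a T aA Tb aT; apply: (Acl a) => //.
by apply: wot_opnorm => // n; exact/Ab/aA.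
Qed.

End BoundedOperators.

(** * Compression to a closed subspace *)

Section Nondegeneracy.
Variables (R : realType).
Implicit Types (H K : hilbertType R).

Lemma nondegenerateP H K (A : set (H -> K)) : acts_nondegenerately A <->
  forall k, (forall T x, A T -> inner (T x) k = 0) -> k = 0.
Proof.
split=> [/closed_spanT A0 k Ak|A0]; last first.
  apply/closed_spanT => k Ak; apply: A0 => T x AT; apply: Ak.
  by exists T => //; exists x.
by apply: A0 => _ [T AT [x ->]]; exact: Ak.
Qed.

Lemma ess_space_sub H K (A : set (H -> K)) T x :
  A T -> csub_set (ess_space A) (T x).
Proof. by move=> AT; apply: closed_span_sub; exists T => //; exists x. Qed.

Lemma orth_ess_space H K (A : set (H -> K)) k :
  (forall T x, A T -> inner (T x) k = 0) ->
  forall l, csub_set (ess_space A) l -> inner l k = 0.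
Proof.
move=> Ak l Ll; apply: inner_eq0.
have : csub_set (orth_compl [set k]) l.
  apply: closed_span_min Ll => _ [T AT [x ->]] _ -> /=.
  by apply: inner_eq0; exact: Ak.
by move/(_ k erefl).
Qed.

End Nondegeneracy.

Section Compression.
Variables (R : realType) (H : hilbertType R) (L : closed_subspace H).
Local Notation incl := (@Defs.incl R H L).
Implicit Types (l m : csub_type L) (T : H -> H) (b : csub_type L -> csub_type L).

Lemma incl_inner l m : inner (incl l) (incl m) = inner l m.
Proof. by []. Qed.

Lemma incl_csub l : csub_set L (incl l).
Proof. exact/asboolP/(valP l). Qed.

Lemma inclP x : csub_set L x -> exists l : csub_type L, incl l = x.
Proof. by move=> /asboolP Lx; exists (exist _ x Lx). Qed.

Lemma incl_bounded : bounded_ops incl.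
Proof.
apply/bounded_opsP; split; first by move=> c x y; rewrite /incl linearP.
by exists 1 => // x; rewrite mul1r.
Qed.

Let adji_bounded := adj_bounded incl_bounded.

Lemma inclK : cancel incl (adj incl).
Proof.
by move=> l; apply: inner_inj => m; rewrite -adjP//; exact: incl_bounded.
Qed.

Lemma adj_inclK x : csub_set L x -> incl (adj incl x) = x.
Proof. by move=> /inclP[l <-]; rewrite inclK. Qed.

Lemma adj_incl_orth x : (forall y, csub_set L y -> inner y x = 0) ->
  adj incl x = 0.
Proof.
move=> xL; apply: inner_inj => m; rewrite inner0r -adjP; last exact: incl_bounded.
exact/xL/incl_csub.
Qed.

Lemma compress_bounded T : bounded_ops T -> bounded_ops (compress L T).
Proof.
move=> Tb; rewrite /compress; apply: bounded_comp incl_bounded.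
exact: bounded_comp.
Qed.

Lemma extend_bounded b : bounded_ops b -> bounded_ops (extend b).
Proof.
move=> bb; rewrite /extend; apply: bounded_comp adji_bounded.
exact: bounded_comp incl_bounded bb.
Qed.

Lemma extendK b : compress L (extend b) = b.
Proof. by apply/funext => l; rewrite /compress /extend /= !inclK. Qed.

Lemma extend_comp b c : extend (b \o c) = extend b \o extend c.
Proof. by apply/funext => x; rewrite /extend /= inclK. Qed.

Lemma compress_lincomb (c : R[i]) S T :
  compress L (c *: S + T) = c *: compress L S + compress L T.
Proof.
apply/funext => x; rewrite /compress /=.
exact: (bounded_linear adji_bounded c (S (incl x)) (T (incl x))).
Qed.

Lemma extend_inj b c : extend b = extend c -> b = c.
Proof. by move=> bc; rewrite -[b]extendK bc extendK. Qed.

Lemma adj_compress T : bounded_ops T -> adj (compress L T) = compress L (adj T).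
Proof.
move=> Tb; rewrite /compress (adj_comp (bounded_comp adji_bounded Tb) incl_bounded).
by rewrite (adj_comp adji_bounded Tb) (adjK incl_bounded).
Qed.

Lemma wot_extend (b : nat -> csub_type L -> csub_type L) c :
  wot_cvg b c -> wot_cvg (fun n => extend (b n)) (extend c).
Proof. by move=> bc; apply/wot_compr/wot_compl => //; exact: incl_bounded. Qed.

Lemma wot_compress (a : nat -> H -> H) T :
  wot_cvg a T -> wot_cvg (fun n => compress L (a n)) (compress L T).
Proof. by move=> aT; apply/wot_compr/wot_compl. Qed.

(** Extension by zero inverts the compression on A and both maps preserve WOT
    limits and the algebraic operations, so every closure property of A passes
    to its compression; nondegeneracy is the hypothesis that A H is total in L. *)
Lemma compress_sigmastar (A : set (H -> H)) :
  A `<=` @bounded_ops R H H -> is_subspace A ->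
  (forall S T, A S -> A T -> A (S \o T)) -> (forall T, A T -> A (adj T)) ->
  wot_seq_closed A -> (forall T, A T -> extend (compress L T) = T) ->
  (forall k, csub_set L k -> (forall T x, A T -> inner (T x) k = 0) -> k = 0) ->
  sigmastar_algebra (compress L @` A).
Proof.
move=> Ab Asub Acomp Aadj Acl AL And.
have imb : compress L @` A `<=` @bounded_ops R _ _.
  by move=> _ [T AT <-]; exact/compress_bounded/Ab.
have imcl : wot_seq_closed (compress L @` A).
  move=> b c Ab' cb bc; exists (extend c); last exact: extendK.
  apply: (Acl (fun n => extend (b n))); last exact: wot_extend.
    by move=> n; have [T AT <-] := Ab' n; rewrite AL.
  exact: extend_bounded.
have compress_comp S T : A S -> A T ->
    compress L (S \o T) = compress L S \o compress L T.
  by move=> AS AT; apply: extend_inj; rewrite extend_comp !AL//; exact: Acomp.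
split => //; last first.
  apply/nondegenerateP => k kA.
  have -> : k = adj incl (incl k) by rewrite inclK.
  rewrite (And (incl k) (incl_csub k)); first by rewrite op0//; case: adji_bounded.
  move=> T x AT; rewrite -(AL T AT) /extend.
  by rewrite incl_inner; apply: kA; exists T.
split => //.
- split; first by exists 0; [case: Asub|apply: extend_inj; rewrite AL//; case: Asub].
  move=> c _ _ [S AS <-] [T AT <-]; exists (c *: S + T); first exact: Asub.2.
  exact: compress_lincomb.
- by move=> _ _ [S AS <-] [T AT <-]; exists (S \o T); [exact: Acomp|exact: compress_comp].
- move=> _ [T AT <-]; exists (adj T); first exact: Aadj.
  by rewrite adj_compress//; exact: Ab.
- exact: wot_seq_closed_norm_closed.
Qed.

End Compression.

(** * Modules represented by operators *)

Section OperatorRepresentation.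
Variables (R : realType) (H K : hilbertType R) (A : set (H -> H)).
Variables (V : lmodType R[i]) (X : set V).
Variables (act : V -> (H -> H) -> V) (ip : V -> V -> (H -> H)).
Variable r : V -> H -> K.

(** The module identities hold after applying the injective map r, where they
    are identities between operators.  The module norm of x is the operator norm
    of r x, so a Cauchy sequence converges to an operator, which is in the image
    of r because norm limits are WOT limits.  The interior tensor product is the
    closed span of the vectors r x h. *)
Lemma sigmastar_module_of_operators :
  sigmastar_algebra A -> is_subspace X ->
  (forall x, X x -> bounded_ops (r x)) ->
  (forall (c : R[i]) x y, X x -> X y -> r (c *: x + y) = c *: r x + r y) ->
  (forall x, X x -> r x = 0 -> x = 0) ->
  (forall x a, X x -> A a -> X (act x a) /\ r (act x a) = r x \o a) ->
  (forall x y, X x -> X y -> A (ip x y) /\ ip x y = adj (r x) \o r y) ->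
  wot_seq_closed (r @` X) ->
  sigmastar_module A X act ip.
Proof.
move=> sA sX rb rl r0 ract rip rcl; have [cA ndA Acl] := sA.
have [Ab Asub Acomp Aadj _] := cA.
have rB x y : X x -> X y -> r (x - y) = r x - r y.
  by move=> Xx Xy; rewrite addrC -scaleN1r rl// scaleN1r addrC.
have rinj x y : X x -> X y -> r x = r y -> x = y.
  move=> Xx Xy rxy; apply/eqP; rewrite -subr_eq0; apply/eqP/r0.
    exact: is_subspaceB.
  by rewrite rB// rxy subrr.
have Xl (c : R[i]) x y : X x -> X y -> X (c *: x + y) by apply: sX.2.
have Xact x a : X x -> A a -> X (act x a) by move=> Xx Aa; case: (ract x a).
have ractE x a : X x -> A a -> r (act x a) = r x \o a.
  by move=> Xx Aa; case: (ract x a).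
have Aip x y : X x -> X y -> A (ip x y) by move=> Xx Xy; case: (rip x y).
have ripE x y : X x -> X y -> ip x y = adj (r x) \o r y.
  by move=> Xx Xy; case: (rip x y).
have mn x : X x -> module_norm ip x = opnorm (r x).
  move=> Xx; rewrite /module_norm ripE// cstar_identity; last exact: rb.
  by rewrite sqrtr_sqr ger0_norm// opnorm_ge0//; exact: rb.
split => //; last first.
  (* K may be larger than the closed span L of the vectors r x h, so r x is
     regarded as an operator into L. *)
  pose L := ess_space (r @` X); pose incl := @Defs.incl R K L.
  have Lr x h : X x -> csub_set L (r x h).
    by move=> Xx; apply: ess_space_sub; exists x.
  pose t x h : csub_type L := adj (@Defs.incl R K L) (r x h).
  have it x h : X x -> incl (t x h) = r x h by move=> Xx; apply: adj_inclK; exact: Lr.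
  have inj (k l : csub_type L) : incl k = incl l -> k = l by exact: val_inj.
  have ib : bounded_ops incl by exact: incl_bounded.
  have il : linear incl by exact: bounded_linear.
  exists (csub_type L), t; split.
    split.
    - by move=> x c h k Xx; apply: inj; rewrite il !it// (bounded_linear (rb x Xx)).
    - by move=> c x y h Xx Xy; apply: inj; rewrite il !it// ?rl//; exact: Xl.
    - by move=> x a h Xx Aa; apply: inj; rewrite !it// ?ractE//; exact: Xact.
    - move=> x y h k Xx Xy; rewrite -[LHS]/(inner (incl (t x h)) (incl (t y k))).
      by rewrite !it// ripE//= -adjP//; exact: rb.
    - apply/nondegenerateP => k kX; apply: inj.
      rewrite (op0 il); apply: inner_self_eq0.
      apply: (@orth_ess_space _ _ _ (r @` X)); last exact: incl_csub.
      move=> _ x [y Xy <-]; rewrite -it// -[LHS]/(inner (t y x) k).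
      by apply: kX; exists y.
  move=> a T aX Tb aT.
  have [x Xx xT] : (r @` X) (incl \o T).
    apply: (rcl (fun n => incl \o a n)).
    - move=> n; have [x Xx <-] := aX n; exists x => //.
      by apply/funext => h; rewrite /= it.
    - exact: bounded_comp ib Tb.
    - exact: wot_compl ib aT.
  by exists x => //; apply/funext => h; apply: inj; rewrite it// xT.
split => //.
- split => //.
  + move=> c x y a Xx Xy Aa.
    apply: rinj; [exact: Xact (Xl _ _ _ Xx Xy) Aa|exact: Xl (Xact _ _ _ _) (Xact _ _ _ _)|].
    by rewrite rl ?ractE ?rl//; [exact: Xl|exact: Xact|exact: Xact].
  + move=> c x a b Xx Aa Ab'.
    have Aab : A (c *: a + b) by exact: Asub.2.
    apply: rinj; [exact: Xact|exact: Xl (Xact _ _ _ _) (Xact _ _ _ _)|].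
    rewrite rl ?ractE//; [|exact: Xact|exact: Xact].
    by apply/funext => h; exact: (bounded_linear (rb x Xx) c (a h) (b h)).
  + move=> x a b Xx Aa Ab'; have Aab := Acomp _ _ Aa Ab'.
    have Xa := Xact _ _ Xx Aa.
    by apply: rinj; [exact: Xact|exact: Xact|rewrite !ractE].
- split => //.
  + move=> c x y z Xx Xy Xz; rewrite !ripE ?rl//; last exact: Xl.
    apply/funext => h.
    exact: (bounded_linear (adj_bounded (rb x Xx)) c (r y h) (r z h)).
  + by move=> x y a Xx Xy Aa; rewrite !ripE ?ractE//; exact: Xact.
  + move=> x y Xx Xy; rewrite !ripE// adj_comp; [|exact/adj_bounded/rb|exact: rb].
    by rewrite adjK//; exact: rb.
  + move=> x Xx; split=> [h|].
      by rewrite ripE//= -adjP; [exact: dnorm_ge0|exact: rb].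
    rewrite ripE// => ip0; apply: r0 => //; apply/funext => h.
    apply: inner_self_eq0; rewrite adjP; last exact: rb.
    by rewrite -[adj _ _]/((adj (r x) \o r x) h) ip0 inner0r.
- move=> u Xu uc.
  have XB m n : X (u m - u n) by exact: is_subspaceB.
  have [e e0|T Tb uT] := @bounded_ops_complete _ _ _ (r \o u) (fun n => rb _ (Xu n)).
    have [N uN] := uc e e0; exists N => m n Nm Nn.
    by rewrite /= -rB// -mn//; exact: uN.
  have [x Xx xT] : (r @` X) T.
    apply: (rcl (r \o u)) => //; first by move=> n; exists (u n).
    by apply: wot_opnorm => // n; exact: rb.
  exists x => //; move: uT; rewrite -xT.
  suff -> : (fun n => module_norm ip (u n - x)) = (fun n => opnorm ((r \o u) n - r x)) by [].
  by apply/funext => n; rewrite mn ?rB//; exact: is_subspaceB.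
Qed.

End OperatorRepresentation.

(** * Uniqueness of the interior tensor product *)

Section UniquenessOfTensor.
Variables (R : realType) (I : Type) (K K' : hilbertType R).
Variables (e : I -> K) (e' : I -> K').
Hypothesis gram : forall i j, inner (e' i) (e' j) = inner (e i) (e j).
Hypothesis e_total : forall k, (forall i, inner (e i) k = 0) -> k = 0.
Hypothesis e'_total : forall k, (forall i, inner (e' i) k = 0) -> k = 0.

Lemma total_eq (k l : K) : (forall i, inner (e i) k = inner (e i) l) -> k = l.
Proof.
move=> kl; apply/eqP; rewrite -subr_eq0; apply/eqP/e_total => i.
by rewrite innerBr kl subrr.
Qed.

Lemma total_eq' (k l : K') : (forall i, inner (e' i) k = inner (e' i) l) -> k = l.
Proof.
move=> kl; apply/eqP; rewrite -subr_eq0; apply/eqP/e'_total => i.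
by rewrite innerBr kl subrr.
Qed.

(** Linear combinations of the pairs (e i, e' i) form the graph of an isometry;
    completeness of K' extends it to the closed span of e, which is K. *)
Lemma gram_isometry : exists U : K -> K',
  [/\ bounded_ops U, forall i, U (e i) = e' i & forall i, adj U (e' i) = e i].
Proof.
(* The graph of the isometry on the algebraic span; taking the span of pairs
   makes the well-definedness of the map part of the Gram identity. *)
pose P : set (K * K')%type := lspan [set p | exists i, p = (e i, e' i)].
have Psub : is_subspace P by exact: lspan_subspace.
have Pe k k' : P (k, k') -> forall i, inner (e' i) k' = inner (e i) k.
  move=> Pk i; have : [set p : K * K' | inner (e' i) p.2 = inner (e i) p.1] (k, k').
    apply: lspan_min Pk; last by move=> _ [j ->] /=; exact: gram.
    split=> [|c [x x'] [y y'] /= xx yy]; first by rewrite /= !inner0r.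
    by rewrite !innerPr xx yy.
  by [].
have Pinner k k' l l' : P (k, k') -> P (l, l') -> inner k' l' = inner k l.
  move=> Pk Pl; have : [set p : K * K' | inner p.2 l' = inner p.1 l] (k, k').
    apply: lspan_min Pk; last by move=> _ [j ->] /=; exact: Pe.
    split=> [|c [x x'] [y y'] /= xx yy]; first by rewrite /= !inner0l.
    by rewrite !innerDl !innerZl xx yy.
  by [].
have Pnrm k k' : P (k, k') -> nrm k' = nrm k.
  move=> Pk; apply/eqP; rewrite -(eqrXn2 (_ : (0 < 2)%N)) ?nrm_ge0//.
  by rewrite -!Re_inner_self (Pinner _ _ _ _ Pk Pk).
have Pdom k : lspan (range e) k -> exists k', P (k, k').
  move=> ek; apply: (ek [set k | exists k', P (k, k')]); split.
    split; first by exists 0; case: Psub.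
    move=> c x y [x' Px] [y' Py]; exists (c *: x' + y').
    exact: Psub.2 Px Py.
  by move=> _ [i _ <-]; exists (e' i); apply: lspan_sub; exists i.
have dense k : csub_set (closed_span (range e)) k.
  have /closed_spanT -> // : forall x, (forall y, range e y -> inner y x = 0) -> x = 0.
  by move=> x xe; apply: e_total => i; apply: xe; exists i.
have ex k : exists k', (forall i, inner (e' i) k' = inner (e i) k) /\ nrm k' <= nrm k.
  have [u ue uk] := closure_cvgn (dense k).
  have [u' uP] := choice (fun n => Pdom _ (ue n)).
  have [k' uk'] : exists k' : K', u' @ \oo --> k'.
    apply: hilbert_complete => d d0; have d2 : 0 < d / 2 by rewrite divr_gt0.
    have [N uN] := (cvgn_nrmP _ _).1 uk _ d2.
    exists N => m n /uN um /uN un.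
    have /Pnrm -> : P (u m - u n, u' m - u' n).
      exact: (is_subspaceB Psub (uP m) (uP n)).
    have -> : u m - u n = (u m - k) - (u n - k) by rewrite opprB addrA subrK.
    rewrite (le_lt_trans (nrmD _ _))// nrmN; move: um un; lra.
  exists k'; split=> [i|].
    apply: (cvgc_unique (inner_cvgr (y := e' i) uk')).
    have := inner_cvgr (y := e i) uk.
    by under eq_cvg do rewrite -(Pe _ _ (uP _)).
  apply/ler_addgt0Pr => d d0; have d2 : 0 < d / 2 by rewrite divr_gt0.
  have [N uN] := (cvgn_nrmP _ _).1 uk _ d2.
  have [M uM] := (cvgn_nrmP _ _).1 uk' _ d2.
  have := uN _ (leq_maxl N M); have := uM _ (leq_maxr N M).
  set n := maxn N M => un' un.
  have : nrm k' <= nrm (u' n) + nrm (u' n - k').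
    by rewrite -[k' in X in X <= _](subKr (u' n)) (le_trans (nrmD _ _))// nrmN.
  have : nrm (u n) <= nrm k + nrm (u n - k).
    by rewrite -[u n in X in X <= _](subrK k) addrC nrmD.
  by rewrite (Pnrm _ _ (uP n)); move: un un'; lra.
have [U UP] := choice ex.
have Ue i : U (e i) = e' i.
  by apply: total_eq' => j; rewrite gram; case: (UP (e i)) => ->.
have Ub : bounded_ops U.
  apply/bounded_opsP; split; last by exists 1 => // x; rewrite mul1r; case: (UP x).
  move=> c x y; apply: total_eq' => i; rewrite innerPr.
  by rewrite !(UP _).1 innerPr.
exists U; split => // i; apply: total_eq => j.
by rewrite -adjP// Ue gram.
Qed.

End UniquenessOfTensor.

Section InteriorTensor.
Variables (R : realType) (H : hilbertType R) (A : set (H -> H)).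
Variables (V : lmodType R[i]) (X : set V).
Variables (act : V -> (H -> H) -> V) (ip : V -> V -> (H -> H)).
Hypotheses (cA : cstar_algebra A) (mX : module_inner_product A X act ip).

(** |t x h|^2 = <h, <x|x> h> is at most the norm of <x|x> times |h|^2. *)
Lemma interior_tensor_bounded (K : hilbertType R) (t : V -> H -> K) x :
  interior_tensor A X act ip t -> X x -> bounded_ops (t x).
Proof.
move=> [tl _ _ tip _] Xx; apply/bounded_opsP; split.
  by move=> c h k; exact: tl.
have ipb : bounded_ops (ip x x).
  by have [Ab _ _ _ _] := cA; have [Aip _ _ _ _] := mX; exact/Ab/Aip.
(* Any upper bound of the square root of m = opnorm (ip x x) will do, and
   m <= (1 + m)^2. *)
exists (1 + opnorm (ip x x)) => [|h]; first by rewrite addr_ge0// opnorm_ge0.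
have le1 : nrm (t x h) ^+ 2 <= opnorm (ip x x) * nrm h ^+ 2.
  rewrite -lecR sqr_nrm -[X in X <= _]ger0_norm; last exact: dnorm_ge0.
  rewrite tip// (le_trans (cauchy_schwarz _ _))// lecR expr2 mulrCA.
  by rewrite ler_wpM2l ?nrm_ge0//; exact: opnormP.
rewrite -(ler_pXn2r (_ : (0 < 2)%N)) ?nnegrE ?mulr_ge0 ?nrm_ge0//; last first.
  by rewrite addr_ge0// opnorm_ge0.
apply: (le_trans le1); rewrite exprMn ler_wpM2r ?sqr_ge0//.
by have := opnorm_ge0 ipb; move: (opnorm _) => m; nra.
Qed.

Lemma interior_tensor_adj (K : hilbertType R) (t : V -> H -> K) x y :
  interior_tensor A X act ip t -> X x -> X y -> ip x y = adj (t x) \o t y.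
Proof.
move=> tt Xx Xy; apply/funext => k; apply: inner_inj => h.
have [_ _ _ tip _] := tt; rewrite /= -adjP ?tip//.
exact: interior_tensor_bounded tt Xx.
Qed.

(** The isometry U between the two realizations and its adjoint intertwine t and
    t', so they carry a WOT limit of operators t' x_n back to one of operators
    t x_n, and its preimage x forward again. *)
Lemma interior_tensor_wot_transfer (K K' : hilbertType R)
    (t : V -> H -> K) (t' : V -> H -> K') :
  interior_tensor A X act ip t -> interior_tensor A X act ip t' ->
  wot_seq_closed (t @` X) -> wot_seq_closed (t' @` X).
Proof.
move=> tt tt' tcl.
have [_ _ _ tip /nondegenerateP tnd] := tt.
have [_ _ _ tip' /nondegenerateP tnd'] := tt'.
pose I := ({x | X x} * H)%type.
have [|||U [Ub Ue Ue']] := @gram_isometry _ I K K'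
    (fun i => t (sval i.1) i.2) (fun i => t' (sval i.1) i.2).
- by move=> [[x Xx] h] [[y Xy] k] /=; rewrite tip ?tip'.
- move=> k kt; apply: tnd => _ h [x Xx <-]; exact: (kt (exist _ x Xx, h)).
- move=> k kt; apply: tnd' => _ h [x Xx <-]; exact: (kt (exist _ x Xx, h)).
have Ut x : X x -> U \o t x = t' x.
  by move=> Xx; apply/funext => h; exact: (Ue (exist _ x Xx, h)).
have Ut' x : X x -> adj U \o t' x = t x.
  by move=> Xx; apply/funext => h; exact: (Ue' (exist _ x Xx, h)).
move=> a T aX Tb aT.
have UT := wot_compl (adj_bounded Ub) aT.
have [x Xx xT] : (t @` X) (adj U \o T).
  apply: (tcl (fun n => adj U \o a n)) => //.
    by move=> n; have [x Xx <-] := aX n; exists x => //; rewrite Ut'.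
  exact: bounded_comp (adj_bounded Ub) Tb.
exists x => //; apply: wot_unique aT; rewrite -Ut// xT.
have := wot_compl Ub UT.
suff -> : (fun n => U \o (adj U \o a n)) = a by [].
by apply/funext => n; have [y Xy <-] := aX n; rewrite Ut'// Ut.
Qed.

(** (t x) (t y)^* (t z) is the image of x <y|z>. *)
Lemma interior_tensor_tro (K : hilbertType R) (t : V -> H -> K) :
  is_subspace X -> module_action A X act ->
  interior_tensor A X act ip t -> tro (t @` X).
Proof.
move=> [X0 XD] [Xact _ _ _] tt; have [_ tl ta _ _] := tt.
have [Aip _ _ _ _] := mX.
split.
- by move=> _ [x Xx <-]; exact: interior_tensor_bounded tt Xx.
- split.
    exists 0 => //; apply/funext => h; have := tl (-1) 0 0 h X0 X0.
    by rewrite scaler0 addr0 scaleN1r addNr.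
  move=> c _ _ [x Xx <-] [y Xy <-]; exists (c *: x + y); first exact: XD.
  by apply/funext => h; rewrite tl.
- move=> _ _ _ [x Xx <-] [y Xy <-] [z Xz <-].
  exists (act x (ip y z)); first exact: Xact (Aip _ _ Xy Xz).
  apply/funext => h; rewrite ta//; last exact: Aip.
  by rewrite (interior_tensor_adj tt Xy Xz).
Qed.

End InteriorTensor.

(** * The orthogonal direct sum of two Hilbert spaces *)

Section HilbertSum.
Variables (R : realType) (H K : hilbertType R).

(** A separate name for the product, whose own norm is the maximum norm. *)
Definition hsum : Type := (H * K)%type.
HB.instance Definition _ := GRing.Lmodule.copy hsum (H * K)%type.

Implicit Types x y : hsum.

Definition hsum_nrm x : R := Num.sqrt (nrm x.1 ^+ 2 + nrm x.2 ^+ 2).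
Definition hsum_norm x : R[i] := (hsum_nrm x)%:C.
Definition hsum_dot x y : R[i] := dotp x.1 y.1 + dotp x.2 y.2.

Lemma sqr_hsum_nrm x : hsum_nrm x ^+ 2 = nrm x.1 ^+ 2 + nrm x.2 ^+ 2.
Proof. by rewrite sqr_sqrtr// addr_ge0 ?sqr_ge0. Qed.

Lemma hsum_norm_sqr x : hsum_norm x ^+ 2 = hsum_dot x x.
Proof. by rewrite -rmorphXn /= sqr_hsum_nrm rmorphD /= !sqr_nrm. Qed.

Lemma hsum_normD x y : hsum_norm (x + y) <= hsum_norm x + hsum_norm y.
Proof.
rewrite -rmorphD lecR -(ler_pXn2r (_ : (0 < 2)%N)) ?nnegrE ?addr_ge0 ?sqrtr_ge0//.
rewrite sqrrD !sqr_hsum_nrm /=.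
have x0 := sqrtr_ge0 (nrm x.1 ^+ 2 + nrm x.2 ^+ 2).
have y0 := sqrtr_ge0 (nrm y.1 ^+ 2 + nrm y.2 ^+ 2).
(* Cauchy-Schwarz in the plane, from Lagrange's identity. *)
have cs : nrm x.1 * nrm y.1 + nrm x.2 * nrm y.2 <= hsum_nrm x * hsum_nrm y.
  rewrite -(ler_pXn2r (_ : (0 < 2)%N)) ?nnegrE ?addr_ge0 ?mulr_ge0 ?nrm_ge0//.
  rewrite exprMn !sqr_hsum_nrm -subr_ge0.
  have -> : (nrm x.1 ^+ 2 + nrm x.2 ^+ 2) * (nrm y.1 ^+ 2 + nrm y.2 ^+ 2) -
      (nrm x.1 * nrm y.1 + nrm x.2 * nrm y.2) ^+ 2 =
      (nrm x.1 * nrm y.2 - nrm x.2 * nrm y.1) ^+ 2 by ring.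
  exact: sqr_ge0.
have d1 : nrm (x.1 + y.1) ^+ 2 <= (nrm x.1 + nrm y.1) ^+ 2.
  by rewrite ler_pXn2r ?nnegrE ?addr_ge0 ?nrm_ge0// nrmD.
have d2 : nrm (x.2 + y.2) ^+ 2 <= (nrm x.2 + nrm y.2) ^+ 2.
  by rewrite ler_pXn2r ?nnegrE ?addr_ge0 ?nrm_ge0// nrmD.
rewrite (le_trans (lerD d1 d2))// -subr_ge0.
have -> : nrm x.1 ^+ 2 + nrm x.2 ^+ 2 + hsum_nrm x * hsum_nrm y *+ 2 +
    (nrm y.1 ^+ 2 + nrm y.2 ^+ 2) -
    ((nrm x.1 + nrm y.1) ^+ 2 + (nrm x.2 + nrm y.2) ^+ 2) =
    (hsum_nrm x * hsum_nrm y - (nrm x.1 * nrm y.1 + nrm x.2 * nrm y.2)) *+ 2 by ring.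
by rewrite mulrn_wge0// subr_ge0.
Qed.

Lemma hsum_normZ (c : R[i]) x : hsum_norm (c *: x) = `|c| * hsum_norm x.
Proof.
have [r r0 cr] := normc_real c.
have Z (J : hilbertType R) (z : J) : nrm (c *: z) = r * nrm z.
  by apply: complexI; rewrite -nrmE normrZ rmorphM /= -nrmE cr.
rewrite cr -rmorphM; congr (_%:C).
rewrite /hsum_nrm !Z !exprMn -mulrDr sqrtrM ?sqr_ge0//.
by rewrite sqrtr_sqr ger0_norm.
Qed.

Lemma hsum_norm_eq0 x : hsum_norm x = 0 -> x = 0.
Proof.
move=> /(@complexI R) x0; have : hsum_nrm x ^+ 2 = 0 by rewrite x0 expr0n.
rewrite sqr_hsum_nrm => /eqP; rewrite paddr_eq0 ?sqr_ge0// !sqrf_eq0.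
by case: x {x0} => a b /= /andP[/eqP/nrm_eq0 -> /eqP/nrm_eq0 ->].
Qed.

HB.instance Definition _ :=
  Lmodule_isNormed.Build R[i] hsum hsum_normD hsum_normZ hsum_norm_eq0.

Lemma hsum_fst_le x : `|x.1| <= `|x : hsum|.
Proof.
rewrite nrmE lecR -(ler_pXn2r (_ : (0 < 2)%N)) ?nnegrE ?nrm_ge0 ?sqrtr_ge0//.
by rewrite sqr_hsum_nrm lerDl sqr_ge0.
Qed.

Lemma hsum_snd_le x : `|x.2| <= `|x : hsum|.
Proof.
rewrite nrmE lecR -(ler_pXn2r (_ : (0 < 2)%N)) ?nnegrE ?nrm_ge0 ?sqrtr_ge0//.
by rewrite sqr_hsum_nrm lerDr sqr_ge0.
Qed.

Lemma hsum_norm_le x : `|x : hsum| <= `|x.1| + `|x.2|.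
Proof.
rewrite !nrmE -rmorphD lecR -(ler_pXn2r (_ : (0 < 2)%N)) ?nnegrE;
  rewrite ?addr_ge0 ?nrm_ge0 ?sqrtr_ge0//.
by rewrite sqr_hsum_nrm sqrrD lerD2r lerDl mulrn_wge0// mulr_ge0 ?nrm_ge0.
Qed.

Lemma hsum_complete (F : set_system hsum) : ProperFilter F -> cauchy F -> cvg F.
Proof.
move=> FF /cauchy_ballP Fc.
have [h Fh] : exists h : H, ((fun x : hsum => x.1) @ F) --> h.
  apply/cvg_ex; apply: cauchy_cvg; apply/cauchy_ballP => e e0.
  have [A [FA1 FA2] AE] := Fc e e0.
  exists ((fun x : hsum => x.1) @` A.1, (fun x : hsum => x.1) @` A.2) => /=.
    split; [apply: filterS FA1|apply: filterS FA2] => x Ax; by exists x.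
  move=> [_ _] [/= [a Aa <-] [b Ab <-]].
  have := AE (a, b) (conj Aa Ab); rewrite /= -!ball_normE /=.
  exact: le_lt_trans (hsum_fst_le (a - b)).
have [k Fk] : exists k : K, ((fun x : hsum => x.2) @ F) --> k.
  apply/cvg_ex; apply: cauchy_cvg; apply/cauchy_ballP => e e0.
  have [A [FA1 FA2] AE] := Fc e e0.
  exists ((fun x : hsum => x.2) @` A.1, (fun x : hsum => x.2) @` A.2) => /=.
    split; [apply: filterS FA1|apply: filterS FA2] => x Ax; by exists x.
  move=> [_ _] [/= [a Aa <-] [b Ab <-]].
  have := AE (a, b) (conj Aa Ab); rewrite /= -!ball_normE /=.
  exact: le_lt_trans (hsum_snd_le (a - b)).
apply/cvg_ex; exists ((h, k) : hsum).
apply/cvgrPdist_lt => e e0; have e2 : 0 < e / 2 by rewrite divr_gt0.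
near=> x.
apply: (le_lt_trans (hsum_norm_le ((h, k) - x))).
rewrite [e]splitr ltrD//=.
  by near: x; move/cvgrPdist_lt: Fh; apply.
by near: x; move/cvgrPdist_lt: Fk; apply.
Unshelve. all: by end_near. Qed.

HB.instance Definition _ := Uniform_isComplete.Build hsum hsum_complete.
HB.instance Definition _ := CompleteNormedModule.on hsum.

Lemma hsum_dot_bilinear : bilinear_for *%R (Num.conj \; *%R) hsum_dot.
Proof.
split=> [y|x] c u v; rewrite /hsum_dot /=.
  by rewrite !linearPl /= mulrDr addrACA.
by rewrite !linearPr /= mulrDr addrACA.
Qed.

Lemma hsum_dot_hermitian x y :
  hsum_dot x y = (-1) ^+ false * Num.conj (hsum_dot y x).
Proof.
rewrite expr0 mul1r /hsum_dot rmorphD /=.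
by congr (_ + _); rewrite [LHS]hermC expr0 mul1r.
Qed.

Lemma hsum_dot_gt0 x : x != 0 -> 0 < hsum_dot x x.
Proof.
move=> x0; rewrite -hsum_norm_sqr exprn_gt0//.
by rewrite -[hsum_norm x]/(`|x : hsum|) normr_gt0.
Qed.

HB.instance Definition _ :=
  bilinear_isBilinear.Build R[i] hsum hsum R[i] *%R (Num.conj \; *%R)
    hsum_dot hsum_dot_bilinear.
HB.instance Definition _ :=
  isHermitianSesquilinear.Build R[i] hsum false Num.conj hsum_dot
    hsum_dot_hermitian.
HB.instance Definition _ := isDotProduct.Build R[i] hsum hsum_dot hsum_dot_gt0.
HB.instance Definition _ := @isHilbert.Build R hsum hsum_dot hsum_norm_sqr.

Definition inl_sum (h : H) : hsum := (h, 0).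
Definition inr_sum (k : K) : hsum := (0, k).

Lemma inner_sum x y : inner x y = inner x.1 y.1 + inner x.2 y.2.
Proof. by []. Qed.

Lemma inl_sum_bounded : bounded_ops inl_sum.
Proof.
apply/bounded_opsP; split.
  by move=> c x y; apply/pair_eqP; rewrite /= scaler0 addr0 !eqxx.
exists 1 => // x; rewrite mul1r -lecR -!nrmE.
by rewrite (le_trans (hsum_norm_le _))//= normr0 addr0.
Qed.

Lemma inr_sum_bounded : bounded_ops inr_sum.
Proof.
apply/bounded_opsP; split.
  by move=> c x y; apply/pair_eqP; rewrite /= scaler0 addr0 !eqxx.
exists 1 => // x; rewrite mul1r -lecR -!nrmE.
by rewrite (le_trans (hsum_norm_le _))//= normr0 add0r.
Qed.

Lemma adj_inl_sum : adj inl_sum = (fun x => x.1).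
Proof. by apply: adj_unique => h x; rewrite inner_sum /= inner0l addr0. Qed.

Lemma adj_inr_sum : adj inr_sum = (fun x => x.2).
Proof. by apply: adj_unique => h x; rewrite inner_sum /= inner0l add0r. Qed.

End HilbertSum.

(** * Corner modules *)

Section OperatorModulesOverCompressions.
Variables (R : realType).
Implicit Types (H K : hilbertType R).

(** The representation is the restriction of z to L.  It is injective because
    every z in Z vanishes on the orthogonal complement of L. *)
Lemma compressed_module H K (L : closed_subspace H)
    (A : set (H -> H)) (Z : set (H -> K)) :
  A `<=` @bounded_ops R H H -> is_subspace A ->
  (forall S T, A S -> A T -> A (S \o T)) -> (forall T, A T -> A (adj T)) ->
  wot_seq_closed A -> (forall T, A T -> extend (compress L T) = T) ->
  (forall k, csub_set L k -> (forall T x, A T -> inner (T x) k = 0) -> k = 0) ->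
  Z `<=` @bounded_ops R H K -> is_subspace Z -> wot_seq_closed Z ->
  (forall z, Z z -> z \o (@Defs.incl R H L \o adj (@Defs.incl R H L)) = z) ->
  (forall z a, Z z -> A a -> Z (z \o a)) ->
  (forall y z, Z y -> Z z -> A (adj y \o z)) ->
  sigmastar_module (compress L @` A) Z (op_act L) (op_ip L).
Proof.
move=> Ab Asub Acomp Aadj Acl AL And Zb Zsub Zcl ZL ZA ZZ.
have ib := incl_bounded L.
apply: (@sigmastar_module_of_operators _ _ _ _ _ _ _ _
  (fun z => z \o @Defs.incl R H L)) => //.
- exact: compress_sigmastar.
- by move=> z /Zb zb; exact: bounded_comp zb ib.
- move=> z Zz z0; rewrite -(ZL _ Zz); apply/funext => x.
  exact: (congr1 (fun f : _ -> K => f (adj (@Defs.incl R H L) x)) z0).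
- move=> z _ Zz [a Aa <-]; rewrite /op_act AL//; split; first exact: ZA.
  rewrite -{1}(AL a Aa); apply/funext => l.
  by rewrite /extend /= inclK.
- move=> y z Zy Zz; split; first by exists (adj y \o z) => //; exact: ZZ.
  by rewrite /op_ip /compress (adj_comp (Zb _ Zy) ib).
- move=> a T aZ Tb aT; exists (T \o adj (@Defs.incl R H L)); last first.
    by apply/funext => l; rewrite /= inclK.
  apply: (Zcl (fun n => a n \o adj (@Defs.incl R H L))).
  + by move=> n; have [z Zz <-] := aZ n; rewrite (_ : _ \o _ = z)//; exact: ZL.
  + exact: bounded_comp Tb (adj_bounded ib).
  + exact: wot_compr.
Qed.

End OperatorModulesOverCompressions.

Section Corners.
Variables (R : realType).
Implicit Types (H K : hilbertType R).

(** p x lies in the range and x - p x is orthogonal to it, since p = p^*. *)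
Lemma range_projection H (p : H -> H) : projection p ->
  @Defs.incl R H (range_space p) \o adj (@Defs.incl R H (range_space p)) = p.
Proof.
move=> [pb pp pa]; apply/funext => x /=.
have pl := bounded_linear pb; have ppE y : p (p y) = p y by rewrite -[in RHS]pp.
have ial := bounded_linear (adj_bounded (incl_bounded (range_space p))).
have Lp y : csub_set (range_space p) (p y) by apply: closed_span_sub; exists y.
rewrite -[x in LHS](subrK (p x)) (opD _ _ ial) (adj_incl_orth (x := x - p x)).
  by rewrite add0r adj_inclK.
move=> y Ly; apply: inner_eq0.
have : csub_set (orth_compl [set x - p x]) y.
  apply: closed_span_min Ly => _ [z _ <-] _ ->.
  by rewrite adjPr// pa opB// ppE subrr inner0l.
by move/(_ _ erefl).
Qed.

Lemma cornerP H (D : set (H -> H)) (p q : H -> H) T :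
  multiplier_algebra D p -> multiplier_algebra D q ->
  p \o p = p -> q \o q = q ->
  corner p D q T <-> [/\ D T, p \o T = T & T \o q = T].
Proof.
move=> [_ Dp] [_ Dq] pp qq; split=> [[d Dd <-]|[DT pT Tq]].
  have ppE x : p (p x) = p x by rewrite -[in RHS]pp.
  have qqE x : q (q x) = q x by rewrite -[in RHS]qq.
  split; first by apply: (Dq _ _).2; exact: (Dp _ _).1.
  - by apply/funext => x; rewrite /= ppE.
  - by apply/funext => x; rewrite /= qqE.
by exists T => //; rewrite pT Tq.
Qed.

Lemma corner_module K (D : set (K -> K)) (p q : K -> K) :
  sigmastar_algebra D ->
  multiplier_algebra D p -> projection p ->
  multiplier_algebra D q -> projection q ->
  let L := range_space q in
  sigmastar_module (compress L @` corner q D q) (corner p D q)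
    (op_act L) (op_ip L).
Proof.
move=> sD Mp [pb pp pa] Mq [qb qq qa] L.
have [[Db Dsub Dcomp Dadj _] /nondegenerateP Dnd Dcl] := sD.
have qP : @Defs.incl R K L \o adj (@Defs.incl R K L) = q by exact: range_projection.
have cP r T : multiplier_algebra D r -> r \o r = r ->
    corner r D q T <-> [/\ D T, r \o T = T & T \o q = T].
  by move=> Mr rr; exact: cornerP.
have cb r : multiplier_algebra D r -> r \o r = r ->
    corner r D q `<=` @bounded_ops R K K.
  by move=> Mr rr T /(cP r T Mr rr)[/Db].
have csub r : multiplier_algebra D r -> r \o r = r -> is_subspace (corner r D q).
  move=> Mr rr; have rl := bounded_linear Mr.1; split.
    apply/(cP r) => //; split; first by case: Dsub.
    - by apply/funext => x /=; exact: (op0 rl).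
    - by apply/funext => x.
  move=> c S T /(cP r S Mr rr)[DS rS Sq] /(cP r T Mr rr)[DT rT Tq].
  apply/(cP r) => //; split; first exact: Dsub.2.
  - by rewrite -[in RHS]rS -[in RHS]rT; apply/funext => x; exact: rl.
  - by rewrite -[in RHS]Sq -[in RHS]Tq.
have ccl r : multiplier_algebra D r -> r \o r = r -> wot_seq_closed (corner r D q).
  move=> Mr rr a T aC Tb aT; have aP n := (cP r (a n) Mr rr).1 (aC n).
  apply/(cP r) => //; split.
  - by apply: (Dcl a) => // n; case: (aP n).
  - apply: (wot_unique _ aT).
    have := wot_compl Mr.1 aT.
    suff -> : (fun n => r \o a n) = a by [].
    by apply/funext => n; case: (aP n).
  - apply: (wot_unique _ aT).
    have := wot_compr (S := q) aT.
    suff -> : (fun n => a n \o q) = a by [].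
    by apply/funext => n; case: (aP n).
apply: compressed_module; [exact: cb|exact: csub| | |exact: ccl| | |exact: cb|
  exact: csub|exact: ccl| | |].
- move=> S T /(cP q)[]// DS qS Sq /(cP q)[]// DT qT Tq.
  by apply/(cP q) => //; split; [exact: Dcomp|rewrite -[in RHS]qS|rewrite -[in RHS]Tq].
- move=> T /(cP q)[]// DT qT Tq; apply/(cP q) => //; split; first exact: Dadj.
    by rewrite -[in RHS]Tq adj_comp ?qa//; exact: Db.
  by rewrite -[in RHS]qT adj_comp ?qa//; exact: Db.
- move=> T /(cP q)[]// DT qT Tq.
  rewrite -[RHS]qT -[in RHS]Tq -[in RHS]qP; by apply/funext.
- (* A vector k of q K orthogonal to q d^* d q k satisfies d k = 0, and D is
     nondegenerate. *)
  move=> k Lk kC.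
  have qk : q k = k by rewrite -qP /= adj_inclK.
  have Dk d : D d -> d k = 0.
    move=> Dd; apply: inner_self_eq0.
    have C1 : corner q D q (q \o (adj d \o d) \o q).
      by exists (adj d \o d) => //; apply: Dcomp => //; exact: Dadj.
    by have := kC _ k C1; rewrite /= adjP// qa qk -adjPr//; exact: Db.
  apply: Dnd => T x DT; rewrite adjP; last exact: Db.
  by rewrite Dk ?inner0r//; exact: Dadj.
- by move=> z /(cP p)[]// _ _ zq; rewrite qP.
- move=> z a /(cP p)[]// Dz pz zq /(cP q)[]// Da qa' aq.
  by apply/(cP p) => //; split; [exact: Dcomp|rewrite -[in RHS]pz|rewrite -[in RHS]aq].
- move=> y z /(cP p)[]// Dy py yq /(cP p)[]// Dz pz zq.
  apply/(cP q) => //; split; [exact: Dcomp (Dadj _ Dy) Dz| |by rewrite -[in RHS]zq].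
  have qy : q \o adj y = adj y by rewrite -[in RHS]yq (adj_comp (Db _ Dy) qb) qa.
  by rewrite -[in RHS]qy.
Qed.

End Corners.

(** * The algebra generated by a ternary ring of operators *)

Section WeakClosure.
Variables (R : realType).
Implicit Types (H K : hilbertType R).

Lemma wot_seq_closure_sub H K (G : set (H -> K)) : G `<=` wot_seq_closure G.
Proof. by move=> T GT M [_]; apply. Qed.

Lemma wot_seq_closure_min H K (G M : set (H -> K)) :
  M `<=` @bounded_ops R H K -> wot_seq_closed M -> G `<=` M ->
  wot_seq_closure G `<=` M.
Proof. by move=> Mb Mc GM T; apply. Qed.

Lemma wot_seq_closure_bounded H K (G : set (H -> K)) :
  G `<=` @bounded_ops R H K -> wot_seq_closure G `<=` @bounded_ops R H K.
Proof. by move=> Gb; apply: wot_seq_closure_min => // a T _. Qed.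

Lemma wot_seq_closure_closed H K (G : set (H -> K)) :
  wot_seq_closed (wot_seq_closure G).
Proof.
move=> a T aG Tb aT M [[Mb Mc] GM]; apply: (Mc a) => // n.
exact: aG.
Qed.

(** Each operation is separately WOT sequentially continuous, so the identities
    closing G under it extend to the closure in one argument at a time. *)
Lemma wot_seq_closure_star_algebra H (G : set (H -> H)) :
  G `<=` @bounded_ops R H H -> is_subspace G ->
  (forall S T, G S -> G T -> G (S \o T)) -> (forall T, G T -> G (adj T)) ->
  let B := wot_seq_closure G in
  [/\ is_subspace B, forall S T, B S -> B T -> B (S \o T) &
      forall T, B T -> B (adj T)].
Proof.
move=> Gb Gsub Gcomp Gadj B.
have GB : G `<=` B by exact: wot_seq_closure_sub.
have Bb : B `<=` @bounded_ops R H H by exact: wot_seq_closure_bounded.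
have Bcl : wot_seq_closed B by exact: wot_seq_closure_closed.
(* WOT induction: P holds on the closure if it holds on G and passes to WOT
   limits. *)
have ind (P : set (H -> H)) : G `<=` P ->
    (forall a T, (forall n, bounded_ops (a n) /\ P (a n)) -> bounded_ops T ->
       wot_cvg a T -> P T) -> B `<=` P.
  move=> GP Pcl T BT.
  have [] // : [set T | bounded_ops T /\ P T] T.
  apply: (wot_seq_closure_min (G := G)) BT => [S []//| |S GS].
    move=> a S aP Sb aS; split => //; exact: Pcl aS.
  by split; [exact: Gb|exact: GP].
split.
- split; first by apply: GB; case: Gsub.
  move=> c S T BS BT; move: S BS; apply: (ind) => [S GS|a S aP Sb aS]; last first.
    apply: (Bcl (fun n => c *: a n + T)) => [n||]; first by case: (aP n).
      by apply: (bounded_subspace _ _).2 => //; exact: Bb.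
    exact: (@wot_lincomb _ _ _ c a (fun=> T) S T aS (@wot_cst _ _ _ T)).
  move: T BT; apply: (ind) => [T GT|a T aP Tb aT]; first by apply: GB; exact: Gsub.2.
  apply: (Bcl (fun n => c *: S + a n)) => [n||]; first by case: (aP n).
    by apply: (bounded_subspace _ _).2 => //; exact: Gb.
  exact: (@wot_lincomb _ _ _ c (fun=> S) a S T (@wot_cst _ _ _ S) aT).
- move=> S T BS BT; move: S BS; apply: (ind) => [S GS|a S aP Sb aS]; last first.
    apply: (Bcl (fun n => a n \o T)) => [n||]; first by case: (aP n).
      by apply: bounded_comp => //; exact: Bb.
    exact: wot_compr.
  move: T BT; apply: (ind) => [T GT|a T aP Tb aT]; first by apply: GB; exact: Gcomp.
  apply: (Bcl (fun n => S \o a n)) => [n||]; first by case: (aP n).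
    by apply: bounded_comp => //; exact: Gb.
  by apply: wot_compl aT; exact: Gb.
- apply: (ind) => [T GT|a T aP Tb aT]; first by apply: GB; exact: Gadj.
  apply: (Bcl (fun n => adj (a n))) => [n||]; first by case: (aP n).
    exact: adj_bounded.
  by apply: wot_adj => // n; case: (aP n).
Qed.

End WeakClosure.

Section TernaryRings.
Variables (R : realType) (K1 K2 : hilbertType R) (Z : set (K1 -> K2)).
Hypotheses (Ztro : tro Z) (Zcl : wot_seq_closed Z).

Let Zb : Z `<=` @bounded_ops R K1 K2. Proof. by case: Ztro. Qed.
Let Zsub : is_subspace Z. Proof. by case: Ztro. Qed.

Lemma tro_algebra_gen y z : Z y -> Z z -> tro_algebra Z (adj y \o z).
Proof. by move=> Zy Zz; apply: lspan_sub; exists y, z. Qed.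

Lemma tro_algebra_ind (P : set (K1 -> K1)) : is_subspace P ->
  (forall y z, Z y -> Z z -> P (adj y \o z)) -> tro_algebra Z `<=` P.
Proof.
move=> Psub Pgen; apply: lspan_min => // _ [y [z [Zy Zz ->]]]; exact: Pgen.
Qed.

Lemma tro_algebra_bounded : tro_algebra Z `<=` @bounded_ops R K1 K1.
Proof.
apply: tro_algebra_ind; first exact: bounded_subspace.
by move=> y z /Zb/adj_bounded yb /Zb; exact: bounded_comp.
Qed.

Lemma tro_algebra_act z T : Z z -> tro_algebra Z T -> Z (z \o T).
Proof.
move=> Zz; suff : tro_algebra Z `<=` [set T : K1 -> K1 | Z (z \o T)] by apply.
apply: tro_algebra_ind => /=.
  have zl := bounded_linear (Zb Zz); split => /=.
    rewrite (_ : z \o 0 = 0); first by case: Zsub.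
    by apply/funext => x /=; exact: op0.
  move=> c S S' ZS ZS'; rewrite (_ : z \o _ = c *: (z \o S) + (z \o S')).
    exact: Zsub.2.
  by apply/funext => x; exact: zl.
by move=> y w Zy Zw; have [_ _ ter] := Ztro; exact: (ter z y w).
Qed.

Lemma tro_algebra_star :
  [/\ is_subspace (tro_algebra Z),
      forall S T, tro_algebra Z S -> tro_algebra Z T -> tro_algebra Z (S \o T) &
      forall T, tro_algebra Z T -> tro_algebra Z (adj T)].
Proof.
have sub : is_subspace (tro_algebra Z) by exact: lspan_subspace.
have aD c S T : tro_algebra Z S -> tro_algebra Z T -> tro_algebra Z (c *: S + T).
  exact: sub.2.
split => // [S T GS GT|].
- suff : tro_algebra Z `<=` [set S : K1 -> K1 | tro_algebra Z (S \o T)] by apply.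
  apply: tro_algebra_ind => /=.
    by split=> /= [|c S1 S2 ? ?]; [case: sub|exact: aD].
  move=> y z Zy Zz; exact: tro_algebra_gen Zy (tro_algebra_act Zz GT).
- suff GP : tro_algebra Z `<=` [set T : K1 -> K1 | bounded_ops T /\ tro_algebra Z (adj T)].
    by move=> T /GP[].
  apply: tro_algebra_ind => [|y z Zy Zz].
    split=> [|c S T [Sb GS] [Tb GT]].
      split; first by case: (bounded_subspace K1 K1).
      rewrite (_ : adj 0 = 0); first by case: sub.
      by apply: adj_unique => x y; rewrite inner0l inner0r.
    split; first exact: (bounded_subspace _ _).2.
    by rewrite adj_lincomb//; exact: aD.
  have yb := Zb Zy; have zb := Zb Zz; have ayb := adj_bounded yb.
  split; first exact: bounded_comp.
  by rewrite (adj_comp ayb zb) (adjK yb); exact: tro_algebra_gen.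
Qed.

Let B := wot_seq_closure (tro_algebra Z).
Let L := ess_space (tro_algebra Z).
Let P := @Defs.incl R K1 L \o adj (@Defs.incl R K1 L).

Let Bb : B `<=` @bounded_ops R K1 K1.
Proof. exact: wot_seq_closure_bounded tro_algebra_bounded. Qed.

Let Bstar : [/\ is_subspace B, forall S T, B S -> B T -> B (S \o T) &
  forall T, B T -> B (adj T)].
Proof.
have [? ? ?] := tro_algebra_star.
exact: wot_seq_closure_star_algebra tro_algebra_bounded _ _ _.
Qed.

Let Bcl : wot_seq_closed B. Proof. exact: wot_seq_closure_closed. Qed.

(** The bounded b with z b in Z form a WOT sequentially closed set, which
    contains Z^* Z by the ternary law. *)
Lemma tro_closure_act z b : Z z -> B b -> Z (z \o b).
Proof.
move=> Zz Bbb; have zb := Zb Zz.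
suff [] : [set b : K1 -> K1 | bounded_ops b /\ Z (z \o b)] b by [].
apply: (wot_seq_closure_min (G := tro_algebra Z)) Bbb => [T []//||T GT].
  move=> a T aZ Tb aT; split => //; apply: (Zcl (a := fun n => z \o a n)).
  - by move=> n; case: (aZ n).
  - exact: bounded_comp.
  - exact: wot_compl.
by split; [exact: tro_algebra_bounded|exact: tro_algebra_act].
Qed.

Lemma tro_closure_ip y z : Z y -> Z z -> B (adj y \o z).
Proof. by move=> Zy Zz; apply: wot_seq_closure_sub; exact: tro_algebra_gen. Qed.

(** An operator T in the span of Z^* Z maps into L, and so does T^*; hence T is
    unchanged by the projection onto L on either side, a property that passes to
    WOT limits. *)
Lemma tro_closure_compress b : B b -> extend (compress L b) = b.
Proof.
move=> Bbb.
suff [] : [set b : K1 -> K1 | bounded_ops b /\ extend (compress L b) = b] b by [].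
apply: (wot_seq_closure_min (G := tro_algebra Z)) Bbb => [T []//||T GT].
  move=> a T aP Tb aT; split => //; apply: (wot_unique _ aT).
  have := wot_extend (wot_compress (L := L) aT).
  suff -> : (fun n => extend (compress L (a n))) = a by [].
  by apply/funext => n; case: (aP n).
have PT S : tro_algebra Z S -> P \o S = S.
  by move=> GS; apply/funext => x; apply: adj_inclK; exact: ess_space_sub.
have Tb := tro_algebra_bounded GT; have Ib := incl_bounded L.
have AIb := adj_bounded Ib; have Pb : bounded_ops P by exact: bounded_comp.
have aP : adj P = P by rewrite /P (adj_comp Ib AIb) (adjK Ib).
have TP : T \o P = T.
  have [_ _ Gadj] := tro_algebra_star.
  rewrite -(adjK (bounded_comp Tb Pb)) (adj_comp Tb Pb) aP PT ?adjK//.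
  exact: Gadj.
by split => //; rewrite -[in RHS](PT T GT) -[in RHS]TP.
Qed.

Lemma tro_closure_total k : csub_set L k ->
  (forall T x, B T -> inner (T x) k = 0) -> k = 0.
Proof.
move=> Lk kB; apply: inner_self_eq0.
apply: orth_ess_space Lk => T x GT; apply: kB; exact: wot_seq_closure_sub.
Qed.

(** If x is orthogonal to the vectors z^* z k, then |z x|^2 = <z^* z x, x> = 0. *)
Lemma tro_ess z : Z z -> z \o P = z.
Proof.
move=> Zz; have zb := Zb Zz; have zl := bounded_linear zb.
apply/funext => h; apply/eqP; rewrite eq_sym -subr_eq0; apply/eqP.
rewrite /= -(opB _ _ zl); apply: inner_self_eq0; set x := h - _.
have xL l : csub_set L l -> inner l x = 0.
  move=> /inclP[m <-]; rewrite adjP; last exact: incl_bounded.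
  rewrite /x (opB _ _ (bounded_linear (adj_bounded (incl_bounded L)))) /P /=.
  by rewrite inclK subrr inner0r.
rewrite adjPr//; apply: xL; rewrite -[adj z _]/((adj z \o z) x).
by apply: ess_space_sub; exact: tro_algebra_gen.
Qed.

Lemma tro_module_compressed :
  sigmastar_module (compress L @` B) Z (op_act L) (op_ip L).
Proof.
have [Bsub Bcomp Badj] := Bstar.
apply: compressed_module => //.
- exact: tro_closure_compress.
- exact: tro_closure_total.
- exact: tro_ess.
- exact: tro_closure_act.
- exact: tro_closure_ip.
Qed.

Lemma tro_module : acts_nondegenerately B ->
  sigmastar_module B Z (fun z b => z \o b) (fun y z => adj y \o z).
Proof.
move=> Bnd; have [Bsub Bcomp Badj] := Bstar.
apply: (@sigmastar_module_of_operators _ _ _ _ _ _ _ _ id) => //.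
- by split => //; split => //; exact: wot_seq_closed_norm_closed.
- by move=> z b Zz Bbb; split => //; exact: tro_closure_act.
- by move=> y z Zy Zz; split => //; exact: tro_closure_ip.
- by rewrite image_id.
Qed.

End TernaryRings.

(** * The linking algebra *)

Section Linking.
Variables (R : realType) (H K : hilbertType R).

Local Notation M := (hsum H K).
Local Notation i1 := (@inl_sum R H K).
Local Notation i2 := (@inr_sum R H K).

(** For isometries f and g, [entry f g T] is the matrix entry f^* T g of T, and
    [block f a g] is the matrix f a g^* with the single entry a. *)
Definition entry (I J : hilbertType R) (f : J -> M) (g : I -> M) (T : M -> M) :
  I -> J := adj f \o T \o g.

Definition block (I J : hilbertType R) (f : J -> M) (a : I -> J) (g : I -> M) :
  M -> M := f \o a \o adj g.

Section Entry.
Variables (I J : hilbertType R) (f : J -> M) (g : I -> M).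
Hypotheses (fb : bounded_ops f) (gb : bounded_ops g).

Lemma entry_bounded T : bounded_ops T -> bounded_ops (entry f g T).
Proof. by move=> Tb; apply: bounded_comp gb; apply: bounded_comp Tb; exact: adj_bounded. Qed.

Lemma entry_wot a T : wot_cvg a T ->
  wot_cvg (fun n => entry f g (a n)) (entry f g T).
Proof. by move=> aT; apply: wot_compr; apply: wot_compl aT; exact: adj_bounded. Qed.

Lemma entry_lincomb (c : R[i]) S T :
  entry f g (c *: S + T) = c *: entry f g S + entry f g T.
Proof.
by apply/funext => x; exact: (bounded_linear (adj_bounded fb) c (S (g x)) (T (g x))).
Qed.

Lemma entry_adj T : bounded_ops T -> adj (entry f g T) = entry g f (adj T).
Proof.
move=> Tb; rewrite /entry (adj_comp (bounded_comp (adj_bounded fb) Tb) gb).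
by rewrite (adj_comp (adj_bounded fb) Tb) (adjK fb).
Qed.

Lemma block_bounded a : bounded_ops a -> bounded_ops (block f a g).
Proof. by move=> ab; apply: bounded_comp (adj_bounded gb); exact: bounded_comp. Qed.

Lemma block_adj a : bounded_ops a -> adj (block f a g) = block g (adj a) f.
Proof.
move=> ab; rewrite /block (adj_comp (bounded_comp fb ab) (adj_bounded gb)).
by rewrite (adj_comp fb ab) (adjK gb).
Qed.

Lemma block_lincomb (c : R[i]) a b :
  block f (c *: a + b) g = c *: block f a g + block f b g.
Proof.
by apply/funext => x; exact: (bounded_linear fb c (a (adj g x)) (b (adj g x))).
Qed.

Lemma block_wot a T : wot_cvg a T ->
  wot_cvg (fun n => block f (a n) g) (block f T g).
Proof. by move=> aT; apply: wot_compr; exact: wot_compl. Qed.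

End Entry.

Let i1b : bounded_ops i1 := inl_sum_bounded H K.
Let i2b : bounded_ops i2 := inr_sum_bounded H K.

Lemma sum_decomp (x : M) : x = i1 (adj i1 x) + i2 (adj i2 x).
Proof.
rewrite adj_inl_sum adj_inr_sum; case: x => h k.
by apply/pair_eqP; rewrite /= addr0 add0r !eqxx.
Qed.

Lemma adj_inlK : cancel i1 (adj i1).
Proof. by move=> h; rewrite adj_inl_sum. Qed.

Lemma adj_inrK : cancel i2 (adj i2).
Proof. by move=> h; rewrite adj_inr_sum. Qed.

Lemma adj_inl_inr k : adj i1 (i2 k) = 0.
Proof. by rewrite adj_inl_sum. Qed.

Lemma adj_inr_inl h : adj i2 (i1 h) = 0.
Proof. by rewrite adj_inr_sum. Qed.

(** Matrix multiplication, from i1 i1^* + i2 i2^* = 1. *)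
Lemma entry_comp (I J : hilbertType R) (f : J -> M) (g : I -> M) S T :
  bounded_ops f -> bounded_ops S ->
  entry f g (S \o T) =
    (entry f i1 S \o entry i1 g T) + (entry f i2 S \o entry i2 g T).
Proof.
move=> fb Sb; apply/funext => x; rewrite /entry /=.
rewrite [T (g x) in LHS]sum_decomp (opD _ _ (bounded_linear Sb)).
by rewrite (opD _ _ (bounded_linear (adj_bounded fb))).
Qed.

Variables (B : set (H -> H)) (Z : set (H -> K)).
Hypotheses (sB : sigmastar_algebra B) (Zb : Z `<=` @bounded_ops R H K).
Hypotheses (Zsub : is_subspace Z) (Zcl : wot_seq_closed Z).
Hypothesis ZB : forall z b, Z z -> B b -> Z (z \o b).
Hypothesis ZZ : forall y z, Z y -> Z z -> B (adj y \o z).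

Let cB : cstar_algebra B. Proof. by case: sB. Qed.
Let Bb : B `<=` @bounded_ops R H H. Proof. by case: cB. Qed.
Let Bsub : is_subspace B. Proof. by case: cB. Qed.
Let Bcomp S T : B S -> B T -> B (S \o T).
Proof. by move: S T; case: cB. Qed.
Let Badj T : B T -> B (adj T). Proof. by move: T; case: cB. Qed.
Let Bcl : wot_seq_closed B. Proof. by case: sB. Qed.

(** The lower right corner of the linking algebra only has to contain Z Z^*, map
    Z to itself and be a WOT sequentially closed *-algebra.  The largest choice
    needs no closure operation and contains the identity, so that it acts
    nondegenerately. *)
Definition left_multipliers : set (K -> K) :=
  [set S | bounded_ops S /\ forall z, Z z -> Z (S \o z) /\ Z (adj S \o z)].

Local Notation E := left_multipliers.

Lemma left_multipliers_subspace : is_subspace E.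
Proof.
split.
  split; first by case: (bounded_subspace K K).
  rewrite (_ : adj 0 = 0).
    by move=> z _; split; case: Zsub.
  by apply: adj_unique => x y; rewrite inner0l inner0r.
move=> c S T [Sb SZ] [Tb TZ]; split; first exact: (bounded_subspace _ _).2.
move=> z Zz; have [Sz aSz] := SZ z Zz; have [Tz aTz] := TZ z Zz; split.
  exact: (Zsub.2 c _ _ Sz Tz).
by rewrite adj_lincomb//; exact: (Zsub.2 (Num.conj c) _ _ aSz aTz).
Qed.

Lemma left_multipliers_comp S T : E S -> E T -> E (S \o T).
Proof.
move=> [Sb SZ] [Tb TZ]; split; first exact: bounded_comp.
move=> z Zz; rewrite (adj_comp Sb Tb); split.
  exact: (SZ _ (TZ _ Zz).1).1.
exact: (TZ _ (SZ _ Zz).2).2.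
Qed.

Lemma left_multipliers_adj T : E T -> E (adj T).
Proof.
move=> [Tb TZ]; split; first exact: adj_bounded.
by move=> z /TZ[]; rewrite adjK.
Qed.

Lemma left_multipliers_closed : wot_seq_closed E.
Proof.
move=> a T aE Tb aT; split => // z Zz; have zb := Zb Zz; split.
  apply: (Zcl (a := fun n => a n \o z)).
  - by move=> n; case: ((aE n).2 z Zz).
  - exact: bounded_comp.
  - exact: wot_compr.
apply: (Zcl (a := fun n => adj (a n) \o z)).
- by move=> n; case: ((aE n).2 z Zz).
- by apply: bounded_comp => //; exact: adj_bounded.
- by apply/wot_compr/wot_adj => // n; case: (aE n).
Qed.

(** For x in Z the operator y z^* x = y (z^* x) is in Z B, hence in Z. *)
Lemma left_multipliers_outer y z : Z y -> Z z -> E (y \o adj z).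
Proof.
move=> Zy Zz; have yb := Zb Zy; have zb := Zb Zz; have azb := adj_bounded zb.
split; first exact: bounded_comp.
move=> x Zx; rewrite (adj_comp yb azb) (adjK zb); split.
  exact: (ZB Zy (ZZ Zz Zx)).
exact: (ZB Zz (ZZ Zy Zx)).
Qed.

(** The upper right entry is tested through T^*, so that only sets of operators
    from H to K occur. *)
Definition linking : set (M -> M) :=
  [set T | [/\ bounded_ops T, B (entry i1 i1 T), Z (entry i2 i1 T),
              Z (entry i2 i1 (adj T)) & E (entry i2 i2 T)]].

Lemma linking_adj T : linking T -> linking (adj T).
Proof.
move=> [Tb T11 T21 T12 T22]; split; first exact: adj_bounded.
- by rewrite -(entry_adj i1b i1b)//; exact: Badj.
- exact: T12.
- by rewrite adjK.
- by rewrite -(entry_adj i2b i2b)//; exact: left_multipliers_adj.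
Qed.

Lemma linking_comp S T : linking S -> linking T -> linking (S \o T).
Proof.
have ent21 S' T' : linking S' -> linking T' -> Z (entry i2 i1 (S' \o T')).
  move=> [Sb S11 S21 S12 S22] [Tb T11 T21 T12 T22].
  rewrite entry_comp//; apply: is_subspaceD => //; first exact: ZB.
  exact: (S22.2 _ T21).1.
move=> CS CT; have := CS; have := CT.
move=> [Tb T11 T21 T12 T22] [Sb S11 S21 S12 S22].
have S12E : entry i1 i2 S = adj (entry i2 i1 (adj S)).
  by rewrite (entry_adj i2b i1b) ?adjK//; exact: adj_bounded.
have T12E : entry i1 i2 T = adj (entry i2 i1 (adj T)).
  by rewrite (entry_adj i2b i1b) ?adjK//; exact: adj_bounded.
split; first exact: bounded_comp.
- rewrite entry_comp//; apply: is_subspaceD => //; first exact: Bcomp.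
  by rewrite S12E; exact: ZZ.
- exact: ent21.
- by rewrite adj_comp//; apply: ent21; exact: linking_adj.
- rewrite entry_comp//; apply: is_subspaceD left_multipliers_subspace _ _.
    by rewrite T12E; exact: left_multipliers_outer.
  exact: left_multipliers_comp.
Qed.

Lemma entry0 (I J : hilbertType R) (f : J -> M) (g : I -> M) :
  bounded_ops f -> entry f g 0 = 0.
Proof. by move=> fb; apply/funext => x; exact: (op0 (bounded_linear (adj_bounded fb))). Qed.

Lemma linking_subspace : is_subspace linking.
Proof.
have B0 : B 0 by case: Bsub.
have Z0 : Z 0 by case: Zsub.
have E0 : E 0 by case: left_multipliers_subspace.
have adj0 : adj (0 : M -> M) = 0.
  by apply: adj_unique => x y; rewrite inner0l inner0r.
split; first by split; rewrite ?adj0 ?entry0//; case: (bounded_subspace M M).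
move=> c S T [Sb S11 S21 S12 S22] [Tb T11 T21 T12 T22].
split; first exact: (bounded_subspace _ _).2.
- by rewrite entry_lincomb//; exact: Bsub.2.
- by rewrite entry_lincomb//; exact: Zsub.2.
- by rewrite adj_lincomb// entry_lincomb//; exact: Zsub.2.
- by rewrite entry_lincomb//; exact: left_multipliers_subspace.2.
Qed.

Lemma linking_closed : wot_seq_closed linking.
Proof.
move=> a T aC Tb aT; have ab n : bounded_ops (a n) by case: (aC n).
have ATb := adj_bounded Tb.
split => //.
- apply: (Bcl (a := fun n => entry i1 i1 (a n))); first by move=> n; case: (aC n).
    exact: entry_bounded.
  exact: entry_wot.
- apply: (Zcl (a := fun n => entry i2 i1 (a n))); first by move=> n; case: (aC n).
    exact: entry_bounded.
  exact: entry_wot.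
- apply: (Zcl (a := fun n => entry i2 i1 (adj (a n)))).
  + by move=> n; case: (aC n).
  + exact: entry_bounded.
  + exact: (entry_wot i2b (wot_adj ab Tb aT)).
- apply: (left_multipliers_closed (a := fun n => entry i2 i2 (a n))).
  + by move=> n; case: (aC n).
  + exact: entry_bounded.
  + exact: entry_wot.
Qed.

Lemma linking_block11 b : B b -> linking (block i1 b i1).
Proof.
move=> Bbb; have bb := Bb Bbb.
have e21 c : entry i2 i1 (block i1 c i1) = 0.
  by apply/funext => x; rewrite /entry /block /= adj_inr_inl.
split; first exact: block_bounded.
- rewrite (_ : entry _ _ _ = b)//.
  by apply/funext => x; rewrite /entry /block /= !adj_inlK.
- by rewrite e21; case: Zsub.
- by rewrite block_adj// e21; case: Zsub.
- rewrite (_ : entry _ _ _ = 0); first by case: left_multipliers_subspace.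
  by apply/funext => x; rewrite /entry /block /= adj_inr_inl.
Qed.

Lemma linking_block21 z : Z z -> linking (block i2 z i1).
Proof.
move=> Zz; have zb := Zb Zz; have zl := bounded_linear zb.
have i2l := bounded_linear i2b; have azl := bounded_linear (adj_bounded zb).
split; first exact: block_bounded.
- rewrite (_ : entry _ _ _ = 0); first by case: Bsub.
  by apply/funext => x; rewrite /entry /block /= adj_inl_inr.
- rewrite (_ : entry _ _ _ = z)//.
  by apply/funext => x; rewrite /entry /block /= adj_inlK adj_inrK.
- rewrite block_adj// (_ : entry _ _ _ = 0); first by case: Zsub.
  by apply/funext => x; rewrite /entry /block /= adj_inr_inl.
- rewrite (_ : entry _ _ _ = 0); first by case: left_multipliers_subspace.
  apply/funext => x; rewrite /entry /block /= adj_inl_inr (op0 zl).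
  exact: adj_inrK.
Qed.

Lemma linking_block22 : linking (block i2 idfun i2).
Proof.
have ib := @bounded_id R K.
have e21 : entry i2 i1 (block i2 idfun i2) = 0.
  by apply/funext => x; rewrite /entry /block /= adj_inr_inl; exact: adj_inrK.
split; first exact: block_bounded.
- rewrite (_ : entry _ _ _ = 0); first by case: Bsub.
  by apply/funext => x; rewrite /entry /block /= adj_inl_inr.
- by rewrite e21; case: Zsub.
- by rewrite block_adj// adj_id e21; case: Zsub.
- rewrite (_ : entry _ _ _ = idfun).
    by split => // z Zz; rewrite adj_id.
  by apply/funext => x; rewrite /entry /block /= !adj_inrK.
Qed.

(** Nondegeneracy: a vector orthogonal to the range of C has its H-component
    orthogonal to B H, and its K-component k orthogonal to k itself, since the
    lower right corner contains the identity. *)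
Lemma linking_sigmastar : sigmastar_algebra linking.
Proof.
have Cb : linking `<=` @bounded_ops R M M by move=> T [].
split; last exact: linking_closed.
  split => //; [exact: linking_subspace|exact: linking_comp|exact: linking_adj|].
  by apply: wot_seq_closed_norm_closed => //; exact: linking_closed.
apply/nondegenerateP => x xC; rewrite [x]sum_decomp.
have -> : adj i1 x = 0.
  have [_ /nondegenerateP Bnd _] := sB; apply: Bnd => b h Bbb.
  rewrite -adjP//; have := xC _ (i1 h) (linking_block11 Bbb).
  by rewrite /block /= adj_inlK.
have -> : adj i2 x = 0.
  apply: inner_self_eq0; have := xC _ x linking_block22.
  by rewrite /block /= adjP.
by rewrite (op0 (bounded_linear i1b)) (op0 (bounded_linear i2b)) addr0.
Qed.

Definition corner_proj : M -> M := block i1 idfun i1.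

Lemma corner_proj_projection : projection corner_proj.
Proof.
have ib := @bounded_id R H.
split; first exact: block_bounded.
  by apply/funext => x; rewrite /corner_proj /block /= adj_inlK.
by rewrite /corner_proj block_adj// adj_id.
Qed.

Lemma corner_proj_multiplier : multiplier_algebra linking corner_proj.
Proof.
have [pb pp pa] := corner_proj_projection.
have left_mul T : linking T -> linking (corner_proj \o T).
  move=> [Tb T11 T21 T12 T22]; split; first exact: bounded_comp.
  - rewrite (_ : entry _ _ _ = entry i1 i1 T)//.
    by apply/funext => x; rewrite /entry /corner_proj /block /= adj_inlK.
  - rewrite (_ : entry _ _ _ = 0); first by case: Zsub.
    by apply/funext => x; rewrite /entry /corner_proj /block /= adj_inr_inl.
  - rewrite adj_comp// pa (_ : entry _ _ _ = entry i2 i1 (adj T))//.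
    by apply/funext => x; rewrite /entry /corner_proj /block /= adj_inlK.
  - rewrite (_ : entry _ _ _ = 0); first by case: left_multipliers_subspace.
    by apply/funext => x; rewrite /entry /corner_proj /block /= adj_inr_inl.
split => // T CT; have Tb : bounded_ops T by case: CT.
split; first exact: left_mul.
rewrite -(adjK (bounded_comp Tb pb)) (adj_comp Tb pb) pa.
by apply: linking_adj; apply: left_mul; exact: linking_adj.
Qed.

Lemma linking_corner11 T :
  corner corner_proj linking corner_proj T <-> exists2 b, B b & T = block i1 b i1.
Proof.
split=> [[S [_ S11 _ _ _] <-]|[b Bbb ->]].
  by exists (entry i1 i1 S) => //.
exists (block i1 b i1); first exact: linking_block11.
by apply/funext => x; rewrite /corner_proj /block /= !adj_inlK.
Qed.

Lemma linking_corner21 T :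
  corner (idfun \- corner_proj) linking corner_proj T <->
  exists2 z, Z z & T = block i2 z i1.
Proof.
have qE (x : M) : (idfun \- corner_proj) x = i2 (adj i2 x).
  rewrite /= /corner_proj /block /= [X in X - _]sum_decomp.
  by rewrite addrC addKr.
split=> [[S [_ _ S21 _ _] <-]|[z Zz ->]].
  exists (entry i2 i1 S) => //; apply/funext => x.
  exact: qE.
exists (block i2 z i1); first exact: linking_block21.
apply/funext => x; rewrite -[LHS]/((idfun \- corner_proj) (block i2 z i1 (corner_proj x))).
by rewrite qE /corner_proj /block /= adj_inrK adj_inlK.
Qed.

End Linking.

(** * Sigma*-modules as corners *)

Section Converse.
Variables (R : realType) (H : hilbertType R) (B : set (H -> H)).
Variables (V : lmodType R[i]) (X : set V).
Variables (act : V -> (H -> H) -> V) (ip : V -> V -> (H -> H)).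

Lemma opnorm_block21 (K : hilbertType R) (a : H -> K) : bounded_ops a ->
  opnorm (block (@inr_sum R H K) a (@inl_sum R H K)) = opnorm a.
Proof.
move=> ab; have i1b := inl_sum_bounded H K; have i2b := inr_sum_bounded H K.
have isom (I J : hilbertType R) (f : I -> J) x : bounded_ops f ->
    cancel f (adj f) -> nrm (f x) = nrm x.
  move=> fb fK; apply/eqP; rewrite -(eqrXn2 (_ : (0 < 2)%N)) ?nrm_ge0//.
  by rewrite -!Re_inner_self adjP// fK.
have bb := block_bounded i2b i1b ab.
apply/eqP; rewrite eq_le; apply/andP; split.
  apply: opnorm_le => //; first exact: opnorm_ge0.
  move=> x; rewrite /block /= (isom _ _ _ _ i2b (@adj_inrK _ _ _)).
  rewrite (le_trans (opnormP _ ab))// ler_wpM2l ?opnorm_ge0//.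
  rewrite -[nrm x]mul1r; apply: nrm_adj_le => // h.
  by rewrite mul1r (isom _ _ _ _ i1b (@adj_inlK _ _ _)).
apply: opnorm_le => //; first exact: opnorm_ge0.
move=> h; have := opnormP (@inl_sum R H K h) bb.
rewrite (isom _ _ _ _ i1b (@adj_inlK _ _ _)) {1}/block /= adj_inlK.
by rewrite (isom _ _ _ _ i2b (@adj_inrK _ _ _)).
Qed.

(** phi x is the matrix with lower left entry t x, and psi b the one with upper
    left entry b, compressed to the range of p.  The inverse of psi reads off the
    upper left entry; both maps are built from compositions with fixed
    operators, so they preserve WOT limits. *)
Lemma linking_representation : sigmastar_module B X act ip ->
  exists (K : hilbertType R) (C : set (K -> K)) (p : K -> K),
    [/\ sigmastar_algebra C, multiplier_algebra C p, projection p &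
      let L := range_space p in
      exists (phi : V -> (K -> K))
             (psi : (H -> H) -> (csub_type L -> csub_type L)),
      [/\ set_bij X (corner (idfun \- p) C p) phi,
          forall (c : R[i]) x y, X x -> X y ->
            phi (c *: x + y) = c *: phi x + phi y,
          forall x, X x -> opnorm (phi x) = module_norm ip x,
          sigmastar_iso B (compress L @` corner p C p) psi &
          (forall x b, X x -> B b ->
            phi (act x b) = op_act L (phi x) (psi b)) /\
          (forall x y, X x -> X y ->
            psi (ip x y) = op_ip L (phi x) (phi y))]].
Proof.
move=> [sB [cB Xsub mact mip _] [K [t [tt tcl]]]].
have [tZb tZsub _] := interior_tensor_tro cB mip Xsub mact tt.
have [Bb Bsub Bcomp Badj _] := cB.
have [_ tl tact tip _] := tt; have [Xact _ _ _] := mact.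
have [Bip _ _ _ ip0] := mip.
have tb x : X x -> bounded_ops (t x) by move=> Xx; apply: tZb; exists x.
have tadj x y : X x -> X y -> ip x y = adj (t x) \o t y.
  by move=> Xx Xy; exact: (interior_tensor_adj cB mip tt Xx Xy).
have tactE x b : X x -> B b -> t (act x b) = t x \o b.
  by move=> Xx Bbb; apply/funext => h; rewrite tact.
have tlE (c : R[i]) x y : X x -> X y -> t (c *: x + y) = c *: t x + t y.
  by move=> Xx Xy; apply/funext => h; rewrite tl.
have tinj x y : X x -> X y -> t x = t y -> x = y.
  move=> Xx Xy txy; apply/eqP; rewrite -subr_eq0; apply/eqP.
  have Xxy : X (x - y) by exact: is_subspaceB.
  apply: (ip0 _ Xxy).2; rewrite tadj// (_ : t (x - y) = 0).
    by apply/funext => h; exact: (op0 (bounded_linear (adj_bounded (bounded_subspace H K).1))).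
  by rewrite addrC -scaleN1r tlE// txy scaleN1r addNr.
have ZB z b : (t @` X) z -> B b -> (t @` X) (z \o b).
  by move=> [x Xx <-] Bbb; exists (act x b); [exact: Xact|exact: tactE].
have ZZ y z : (t @` X) y -> (t @` X) z -> B (adj y \o z).
  by move=> [x Xx <-] [w Xw <-]; rewrite -tadj//; exact: Bip.
pose i1 := @inl_sum R H K; pose i2 := @inr_sum R H K.
have i1b : bounded_ops i1 by exact: inl_sum_bounded.
have i2b : bounded_ops i2 by exact: inr_sum_bounded.
pose C := linking B (t @` X); pose p := @corner_proj R H K.
have sC : sigmastar_algebra C by exact: linking_sigmastar.
have Mp : multiplier_algebra C p by exact: corner_proj_multiplier.
have pp : projection p by exact: corner_proj_projection.
have c11 T : corner p C p T <-> exists2 b, B b & T = block i1 b i1.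
  exact: linking_corner11.
have c21 T : corner (idfun \- p) C p T <-> exists2 z, (t @` X) z & T = block i2 z i1.
  exact: linking_corner21.
exists (hsum H K), C, p; split => // L.
have PL : @Defs.incl R _ L \o adj (@Defs.incl R _ L) = p by exact: range_projection.
pose phi x := block i2 (t x) i1.
pose psi b := compress L (block i1 b i1).
pose g c := entry i1 i1 (extend (c : csub_type L -> csub_type L)).
have extpsi b : extend (psi b) = block i1 b i1.
  rewrite -[LHS]/((@Defs.incl R _ L \o adj (@Defs.incl R _ L)) \o block i1 b i1 \o
    (@Defs.incl R _ L \o adj (@Defs.incl R _ L))) PL.
  by apply/funext => x; rewrite /p /corner_proj /block /= !adj_inlK.
have gpsi b : g (psi b) = b.
  by rewrite /g extpsi; apply/funext => h; rewrite /entry /block /= !adj_inlK.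
have psiB b : B b -> (compress L @` corner p C p) (psi b).
  by move=> Bbb; exists (block i1 b i1) => //; apply/c11; exists b.
have psiP c : (compress L @` corner p C p) c -> exists2 b, B b & c = psi b.
  by move=> [T /c11[b Bbb ->] <-]; exists b.
have psil (c : R[i]) S T : psi (c *: S + T) = c *: psi S + psi T.
  by rewrite /psi block_lincomb// compress_lincomb.
have psic S T : psi (S \o T) = psi S \o psi T.
  apply: extend_inj; rewrite extend_comp !extpsi.
  by apply/funext => x; rewrite /block /= adj_inlK.
have psia S : B S -> psi (adj S) = adj (psi S).
  move=> /Bb Sb; rewrite /psi adj_compress; last exact: block_bounded.
  by rewrite block_adj.
exists phi, psi; split.
- split.
  + by move=> x Xx; apply/c21; exists (t x) => //; exists x.
  + move=> x y; rewrite !inE => Xx Xy phixy; apply: tinj => //.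
    apply/funext => h; have := congr1 (fun T => adj i2 (T (i1 h))) phixy.
    by rewrite /phi /block /= !adj_inlK !adj_inrK.
  + by move=> T /c21[_ [x Xx <-] ->]; exists x.
- by move=> c x y Xx Xy; rewrite /phi tlE// block_lincomb.
- move=> x Xx; rewrite /phi opnorm_block21; last exact: tb.
  rewrite /module_norm tadj// cstar_identity; last exact: tb.
  by rewrite sqrtr_sqr ger0_norm// opnorm_ge0//; exact: tb.
- exists g; split.
  + split; first by split.
    by move=> a T aB BT aT; apply/wot_compress/block_wot.
  + split; first split.
    * by move=> c /psiP[b Bbb ->]; rewrite gpsi.
    * by move=> c _ _ /psiP[a Ba ->] /psiP[b Bbb ->]; rewrite -psil !gpsi.
    * by move=> _ _ /psiP[a Ba ->] /psiP[b Bbb ->]; rewrite -psic !gpsi.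
    * by move=> _ /psiP[b Bbb ->]; rewrite -psia// !gpsi.
    by move=> a T aB BT aT; apply: entry_wot => //; exact: wot_extend.
  + by move=> S BS; exact: gpsi.
  + by move=> _ /psiP[b Bbb ->]; rewrite gpsi.
- split=> [x b Xx Bbb|x y Xx Xy].
    rewrite /op_act extpsi /phi tactE//.
    by apply/funext => y; rewrite /block /= adj_inlK.
  rewrite /op_ip /psi /phi block_adj//; last exact: tb.
  rewrite tadj//; congr (compress L _).
  by apply/funext => z; rewrite /block /= adj_inrK.
Qed.

End Converse.

Theorem theorem3p10 (R : realType) :
  ((forall (H : hilbertType R) (B : set (H -> H)) (V : lmodType R[i])
      (X : set V) (act : V -> (H -> H) -> V) (ip : V -> V -> (H -> H)),
    sigmastar_module B X act ip ->
    forall (K : hilbertType R) (t : V -> H -> K),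
      interior_tensor B X act ip t ->
      tro (t @` X) /\ wot_seq_closed (t @` X))
  /\
  (forall (K1 K2 : hilbertType R) (Z : set (K1 -> K2)),
    tro Z -> acts_nondegenerately Z -> wot_seq_closed Z ->
    let B := wot_seq_closure (tro_algebra Z) in
    let L := ess_space (tro_algebra Z) in
    (acts_nondegenerately B ->
      sigmastar_module B Z (fun z b => z \o b) (fun z1 z2 => adj z1 \o z2)) /\
    (~ acts_nondegenerately B ->
      sigmastar_module (compress L @` B) Z (op_act L) (op_ip L))))
  /\
  ((forall (K : hilbertType R) (D : set (K -> K)) (p q : K -> K),
    sigmastar_algebra D ->
    multiplier_algebra D p -> projection p ->
    multiplier_algebra D q -> projection q ->
    let L := range_space q in
    sigmastar_module (compress L @` corner q D q) (corner p D q)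
      (op_act L) (op_ip L))
  /\
  (forall (H : hilbertType R) (B : set (H -> H)) (V : lmodType R[i])
      (X : set V) (act : V -> (H -> H) -> V) (ip : V -> V -> (H -> H)),
    sigmastar_module B X act ip ->
    exists (K : hilbertType R) (C : set (K -> K)) (p : K -> K),
    [/\ sigmastar_algebra C, multiplier_algebra C p, projection p &
      let L := range_space p in
      exists (phi : V -> (K -> K))
             (psi : (H -> H) -> (csub_type L -> csub_type L)),
      [/\ set_bij X (corner (idfun \- p) C p) phi,
          forall (c : R[i]) x y, X x -> X y ->
            phi (c *: x + y) = c *: phi x + phi y,
          forall x, X x -> opnorm (phi x) = module_norm ip x,
          sigmastar_iso B (compress L @` corner p C p) psi &
          (forall x b, X x -> B b ->
            phi (act x b) = op_act L (phi x) (psi b)) /\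
          (forall x y, X x -> X y ->
            psi (ip x y) = op_ip L (phi x) (phi y))]])).

Proof.
split; split.
- move=> H B V X act ip [sB [cB Xsub mact mip _] [K0 [t0 [tt0 tcl0]]]] K t tt.
  split; first exact: (interior_tensor_tro cB mip Xsub mact tt).
  exact: (interior_tensor_wot_transfer tt0 tt tcl0).
- move=> K1 K2 Z Ztro _ Zcl B L; split=> [Bnd|_].
    exact: tro_module.
  exact: tro_module_compressed.
- by move=> K D p q sD Mp pp Mq qq; exact: corner_module.
- by move=> H B V X act ip; exact: linking_representation.
Qed.
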